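(* Let $n\ge1$ and suppose $\alpha_{\boldsymbol N}(a,b)$ and $\beta_{\boldsymbol N}(a,b)$ form a WP Bailey pair with respect to the matrix $\mathbf B^{(1)}$. For complex parameters $\rho_1,\rho_2$ let \begin{align*} \alpha'_{\boldsymbol N}(a,b)&:=\frac{(\rho_1;q,p)_{|\boldsymbol N|}}{(aq/\rho_2;q,p)_{|\boldsymbol N|}}\prod_{r=1}^n\frac{(\rho_2x_r;q,p)_{N_r}}{(ax_rq/\rho_1;q,p)_{N_r}}\cdot\left(\frac{aq}{\rho_1\rho_2}\right)^{|\boldsymbol N|}\alpha_{\boldsymbol N}\big(a,b\rho_1\rho_2/(aq)\big),\\ \beta'_{\boldsymbol N}(a,b)&:=\frac{(b\rho_1/a;q,p)_{|\boldsymbol N|}}{(aq/\rho_2;q,p)_{|\boldsymbol N|}}\prod_{r=1}^n\frac{(b\rho_2x_r/a;q,p)_{N_r}}{(ax_rq/\rho_1;q,p)_{N_r}}\sum_{\substack{0\le k_r\le N_r\\ r=1,\dots,n}}\Bigg(\frac{(\rho_1;q,p)_{|\boldsymbol k|}}{(b\rho_1/a;q,p)_{|\boldsymbol k|}}\prod_{r=1}^n\frac{(\rho_2x_r;q,p)_{k_r}}{(b\rho_2x_r/a;q,p)_{k_r}}\\ &\quad\times\prod_{r=1}^n\frac{\theta(b\rho_1\rho_2x_rq^{k_r+|\boldsymbol k|}/(aq);p)}{\theta(b\rho_1\rho_2x_r/(aq);p)}\frac{(bx_r;q,p)_{k_r+|\boldsymbol N|}}{(b\rho_1\rho_2x_r/a;q,p)_{|\boldsymbol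 k|+N_r}}\\ &\quad\times\frac{(aq/(\rho_1\rho_2);q,p)_{|\boldsymbol N|-|\boldsymbol k|}}{\prod_{r,s=1}^n(q^{1+k_r-k_s}x_r/x_s;q,p)_{N_r-k_r}}\left(\frac{aq}{\rho_1\rho_2}\right)^{|\boldsymbol k|}\beta_{\boldsymbol k}\big(a,b\rho_1\rho_2/(aq)\big)\Bigg). \end{align*} Then $\alpha'_{\boldsymbol N}(a,b)$ and $\beta'_{\boldsymbol N}(a,b)$ also form a WP Bailey pair with respect to $\mathbf B^{(1)}$.
   Context: Let $q,p$ be complex numbers with $q\neq 0$ and $|p|<1$. For $a\ne 0$ put $\theta(a;p)=\prod_{j\ge 0}(1-ap^j)(1-p^{j+1}/a)$. For an integer $k$ the $q,p$-shifted factorial is $(a;q,p)_k=\prod_{j=0}^{k-1}\theta(aq^j;p)$ if $k\ge 0$ (empty product $=1$), and $(a;q,p)_{k}=\big(\prod_{j=k}^{-1}\theta(aq^{j};p)\big)^{-1}$ if $k<0$. Write $(a_1,\dots,a_m;q,p)_k=(a_1;q,p)_k\cdots(a_m;q,p)_k$. For a tuple $\boldsymbol k=(k_1,\dots,k_n)$, $|\boldsymbol k|=k_1+\cdots+k_n$. The $x_1,\dots,x_n$ are fixed complex parameters. All parameters are nonzero and generic in the sense that no denominators vanish. WP Bailey pair: given a matrix $\mathbf B=(B_{\boldsymbol k\boldsymbol j}(a,b))$ indexed by $n$-tuples of nonnegative integers, two sequences $\alpha_{\boldsymbol N}(a,b)$ and $\beta_{\boldsymbol N}(a,b)$ (indexed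 by $n$-tuples of nonnegative integers and depending on parameters $a,b$) form a WP Bailey pair with respect to $\mathbf B$ if for all $\boldsymbol N$ and all (generic) $a,b$ $$\beta_{\boldsymbol N}(a,b)=\sum_{0\le j_r\le N_r,\ r=1,\dots,n}B_{\boldsymbol N\boldsymbol j}(a,b)\,\alpha_{\boldsymbol j}(a,b).$$ The matrix $\mathbf B^{(1)}$ has entries $$B^{(1)}_{\boldsymbol k\boldsymbol j}(a,b)=\frac{(b/a;q,p)_{|\boldsymbol k|-|\boldsymbol j|}}{\prod_{r,s=1}^n(q^{1+j_r-j_s}x_r/x_s;q,p)_{k_r-j_r}}\prod_{r=1}^n\frac{(bx_r;q,p)_{j_r+|\boldsymbol k|}}{(ax_rq;q,p)_{k_r+|\boldsymbol j|}}.$$ *)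

(* Defs.v *)
From HB Require Import structures.
From mathcomp Require Import all_boot all_order all_algebra.
From mathcomp Require Import all_classical all_reals all_analysis.
Set Implicit Arguments.
Unset Strict Implicit.
Unset Printing Implicit Defensive.
Import Order.TTheory GRing.Theory Num.Theory.
Import numFieldNormedType.Exports.
Local Open Scope classical_set_scope.
Local Open Scope ring_scope.

Definition theta (K : numFieldType) (p a : K) : K :=
  lim ((fun m : nat =>
     \prod_(j < m) ((1 - a * p ^+ j) * (1 - p ^+ j.+1 / a))) @ \oo).

(* The shifted factorial (a;q,p)_k; for k = Negz m = -(m+1) the exponents
   k + i with 0 <= i <= m run through k, ..., -1. *)
Definition qpfact (K : numFieldType) (q p a : K) (k : int) : K :=
  match k with
  | Posz m => \prod_(j < m) theta p (a * q ^+ j)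
  | Negz m => (\prod_(i < m.+1) theta p (a * q ^ (k + i%:Z)))^-1
  end.

Notation multi n := {ffun 'I_n -> nat}.

Definition wt (n : nat) (k : multi n) : nat := (\sum_(r < n) k r)%N.

Definition mle (n : nat) (k N : multi n) : Prop := forall r, (k r <= N r)%N.

Definition sum_below (K : numFieldType) (n : nat) (N : multi n)
    (F : multi n -> K) : K :=
  \sum_(j : {dffun forall r : 'I_n, 'I_(N r).+1}) F [ffun r => j r : nat].

(* generic is the set of parameter values (a, b) for which no denominator
   vanishes. *)
Definition WP_Bailey_pair (K : numFieldType) (n : nat)
    (generic : K -> K -> Prop)
    (B : multi n -> multi n -> K -> K -> K)
    (alpha beta : multi n -> K -> K -> K) : Prop :=
  forall (N : multi n) (a b : K), generic a b ->
    beta N a b = sum_below N (fun j => B N j a b * alpha j a b).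

Section Matrix.
Variables (K : numFieldType) (n : nat) (q p : K) (x : 'I_n -> K).
Local Notation "`( a ; k )" := (qpfact q p a k) (at level 0, a at level 99).

Definition crossfact (k j : multi n) : K :=
  \prod_(r < n) \prod_(s < n)
    `(q ^ (1 + (j r)%:Z - (j s)%:Z) * x r / x s ; (k r)%:Z - (j r)%:Z).

Definition B1 (k j : multi n) (a b : K) : K :=
  `(b / a ; (wt k)%:Z - (wt j)%:Z) / crossfact k j
  * \prod_(r < n) (`(b * x r ; (j r + wt k)%N)
                   / `(a * x r * q ; (k r + wt j)%N)).

Definition B1_generic (a b : K) : Prop :=
  [/\ a != 0, b != 0 &
    forall N j : multi n, mle j N ->
      crossfact N j != 0 /\
      forall r, `(a * x r * q ; (N r + wt j)%N) != 0].

Variables (rho1 rho2 : K).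

Definition alpha' (alpha : multi n -> K -> K -> K)
    (N : multi n) (a b : K) : K :=
  `(rho1 ; wt N) / `(a * q / rho2 ; wt N)
  * (\prod_(r < n) (`(rho2 * x r ; N r) / `(a * x r * q / rho1 ; N r)))
  * (a * q / (rho1 * rho2)) ^+ wt N
  * alpha N a (b * rho1 * rho2 / (a * q)).

Definition beta' (beta : multi n -> K -> K -> K)
    (N : multi n) (a b : K) : K :=
  `(b * rho1 / a ; wt N) / `(a * q / rho2 ; wt N)
  * (\prod_(r < n)
       (`(b * rho2 * x r / a ; N r) / `(a * x r * q / rho1 ; N r)))
  * sum_below N (fun k =>
      `(rho1 ; wt k) / `(b * rho1 / a ; wt k)
      * (\prod_(r < n) (`(rho2 * x r ; k r) / `(b * rho2 * x r / a ; k r)))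
      * (\prod_(r < n)
           (theta p (b * rho1 * rho2 * x r * q ^+ (k r + wt k) / (a * q))
            / theta p (b * rho1 * rho2 * x r / (a * q))
            * (`(b * x r ; (k r + wt N)%N)
               / `(b * rho1 * rho2 * x r / a ; (wt k + N r)%N))))
      * (`(a * q / (rho1 * rho2) ; (wt N)%:Z - (wt k)%:Z) / crossfact N k)
      * (a * q / (rho1 * rho2)) ^+ wt k
      * beta k a (b * rho1 * rho2 / (a * q))).

(* The denominators of alpha' and beta' that do not already occur in B1. *)
Definition prime_generic (a b : K) : Prop :=
  (forall (N : multi n),
     `(a * q / rho2 ; wt N) != 0 /\
     forall r, `(a * x r * q / rho1 ; N r) != 0) /\
  (forall (N k : multi n), mle k N ->
     `(b * rho1 / a ; wt k) != 0 /\
     forall r,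
       [/\ `(b * rho2 * x r / a ; k r) != 0,
           theta p (b * rho1 * rho2 * x r / (a * q)) != 0 &
           `(b * rho1 * rho2 * x r / a ; (wt k + N r)%N) != 0]).

End Matrix.

(* Main.v *)
Require Import Defs.
From HB Require Import structures.
From mathcomp Require Import all_boot all_order all_algebra.
From mathcomp Require Import complex.
From mathcomp Require Import all_classical all_reals all_analysis.
From mathcomp Require Import ring lra zify.
Set Implicit Arguments.
Unset Strict Implicit.
Unset Printing Implicit Defensive.
Import Order.TTheory GRing.Theory Num.Theory.
Import numFieldNormedType.Exports.
Local Open Scope ring_scope.

(** Both sides of the new relation are linear in the values
    [alpha j a (b rho1 rho2 / (a q))].  Substitute the given relation into
    [beta'] and exchange the two summations ([exchange_below]): what remains is,
    for each pair [j <= N], the evaluation of one multiple sum over the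
    multi-indices between [j] and [N] ([coefficient_identity]).  That evaluation
    is the elliptic Jackson summation for the root system A_n ([jackson_sum]),
    with [l = b rho1 rho2 / (a q)] and [d = rho2].

    The summation is proved by interpolation in [a], with [b], [l] and [d] fixed,
    so that [rho1] moves proportionally to [a].  The addition formula of theta
    says that [bracket a c = theta(a c / g) theta(a / c) / a] is an alternating
    kernel of rank two.  Hence a product of [e] such brackets in [a] is a binary
    form of degree [e] in two fixed coordinates ([form]), and a form of degree
    [e] with [e + 1] distinct zeros vanishes ([form_eq0]).  Once denominators are
    cleared, the two sides of the summation are forms of degree [|N| - |j|].  At
    [a = l] only the term [k = j] survives ([jackson_at_l]).  At each of the
    [|N| - |j|] points [a = q^-(1 + |j| + m) / x_i] with [j_i <= m < N_i], the
    terms with [k_i <= m] vanish, and on the others the two sides are, up to a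
    common factor, those of the summation whose lower bound [j] has its [i]-th
    entry replaced by [m + 1] ([summand_upd], [closed_form_upd]).  Induction on
    [|N| - |j|] concludes ([jackson_sum_generic]).  The interpolation points are
    distinct only for generic [b]; since theta is continuous with isolated zeros,
    the remaining values of [b] are limits of generic ones.

    The addition formula is obtained from finite products.  With [P_m] the
    truncation of theta to [2 m] factors, the finite form of the Jacobi triple
    product expands [P_m(x y) P_m(x / y)] into a double sum over [i] and [j]
    ([triple_product]).  The substitution [i = u + v], [j = u - v] separates the
    quadratic exponents of [p] ([jterm_mul_even], [jterm_mul_odd]).  So, up to an
    error of order [|p|^m] and a scalar, [P_m(x y) P_m(x / y) / x] is a two by
    two determinant [g1(x) g0(y) - g0(x) g1(y)].  Such determinants satisfy the
    three-term Pluecker relation, and the relation passes to the limit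
    ([theta_addition]). *)

(** * Integer bounds *)

Lemma absz_triangular (u : int) : (`|(u * u + u)%R|%N)%:Z = u * u + u /\
  (`|u| * `|u| <= `|(u * u + u)%R| + `|u|)%N.
Proof.
case: u => n.
  have -> : Posz n * n + n = (n * n + n)%N by lia.
  by split => //=; rewrite -addnA leq_addr.
have -> : Negz n * Negz n + Negz n = (n * n + n)%N.
  by rewrite NegzE mulrNN -PoszM mulSn mulnS; lia.
by split => //=; rewrite mulSn mulnS; lia.
Qed.

Lemma absz_double (u : int) : (`|(u * 2)%R| <= (`|u| + `|u|).+1)%N /\
  (`|(u * 2 + 1)%R| <= (`|u| + `|u|).+1)%N.
Proof. by split; lia. Qed.

Lemma absz_add_bounds (u v : int) : [/\ (`|(u + 1 + v)%R| <= (`|u| + `|v|).+1)%N,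
  (`|(u + 1 - v)%R| <= (`|u| + `|v|).+1)%N,
  (`|(u + v + 1)%R| <= (`|u| + `|v|).+1)%N &
  (`|(u - v)%R| <= (`|u| + `|v|).+1)%N].
Proof. by split; lia. Qed.

(** * Infinite products with a geometric rate *)

(** The estimates use only a norm with values in an embedded copy of the real
    numbers and the convergence of sequences with a geometric rate.  They are
    stated for an abstract field with these two properties, which the complex
    numbers are shown to have afterwards. *)
Section ThetaAnalysis.
Variables (R : realType) (C : numFieldType) (emb : {rmorphism R -> C}).
Variable nrm : C -> R.
Hypothesis embE : {mono emb : x y / x <= y}.
Hypothesis normE : forall z, `|z| = emb (nrm z).
Hypothesis geometric_complete : forall (c r : R) (z : nat -> C), 0 <= r < 1 ->
  (forall m k, (m <= k)%N -> `|z k - z m| <= emb (c * r ^+ m)) ->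
  exists l : C, (z @ \oo --> l)%classic.
Implicit Types (c r : R).

Let embltE : {mono emb : x y / x < y}.
Proof. exact: leW_mono. Qed.

Let emb_ge0 x : (0 <= emb x) = (0 <= x).
Proof. by rewrite -[X in X <= _](rmorph0 emb) embE. Qed.

Let emb_gt0 x : (0 < emb x) = (0 < x).
Proof. by rewrite -[X in X < _](rmorph0 emb) embltE. Qed.

Let embP (e : C) : 0 < e -> exists2 e' : R, 0 < e' & e = emb e'.
Proof.
move=> e0; exists (nrm e); last by rewrite -normE gtr0_norm.
by rewrite -embltE rmorph0 -normE normr_gt0 gt_eqF.
Qed.

Lemma geometric_tail_le (c r : R) (J m : nat) : 0 <= c -> 0 <= r < 1 ->
  \sum_(J <= j < m) c * r ^+ j <= c * r ^+ J / (1 - r).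
Proof.
move=> c0 /andP[r0 r1].
have r1' : 0 < 1 - r by rewrite subr_gt0.
rewrite ler_pdivlMr // -mulr_sumr -mulrA ler_wpM2l //.
case: (leqP J m) => [Jm|mJ]; last first.
  by rewrite big_geq ?mul0r ?exprn_ge0 // ltnW.
have -> : (\sum_(J <= j < m) r ^+ j) * (1 - r) = r ^+ J - r ^+ m.
  rewrite mulr_suml (eq_bigr (fun j => r ^+ j - r ^+ j.+1)); last first.
    by move=> j _; rewrite exprSr; ring.
  by rewrite (@telescope_sumr_eq _ _ _ (fun j => - r ^+ j)) // => [|k _];
    rewrite opprK addrC.
by rewrite lerBlDr lerDl exprn_ge0.
Qed.

Lemma geometric_small (c r e : R) : 0 <= r < 1 -> 0 < e ->
  exists J, forall m, (J <= m)%N -> c * r ^+ m < e.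
Proof.
move=> /andP[r0 r1] e0.
have /cvgrPdist_lt /(_ e e0) : (geometric c r @ \oo --> (0 : R))%classic.
  by apply: cvg_geometric; rewrite ger0_norm.
case=> J _ HJ; exists J => m Jm.
by have := HJ m Jm; rewrite /= sub0r normrN; apply: le_lt_trans; exact: ler_norm.
Qed.

(** The bounds are uniform in the factors: they depend on the constants [c] and
    [r] of a geometric majorant only.  This uniformity is what makes limits of
    such products continuous in a parameter. *)
Lemma norm_prod_le (c r : R) (v : nat -> C) (J m : nat) : 0 <= c -> 0 <= r < 1 ->
  (forall j, `|v j| <= emb (c * r ^+ j)) ->
  `|\prod_(J <= j < m) (1 + v j)| <= emb (expR (c / (1 - r))).
Proof.
move=> c0 r01 hv; have [r0 r1] := andP r01; rewrite normr_prod.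
apply: (@le_trans _ _ (\prod_(J <= j < m) emb (expR (c * r ^+ j)))).
  apply: ler_prod => j _; rewrite normr_ge0 /=.
  apply: le_trans (ler_normD _ _) _; rewrite normr1.
  apply: (@le_trans _ _ (emb (1 + c * r ^+ j))).
    by rewrite rmorphD rmorph1 lerD2l.
  by rewrite embE expR_ge1Dx.
rewrite -rmorph_prod /= embE -expR_sum ler_expR.
apply: le_trans (geometric_tail_le _ _ c0 r01) _.
have r1' : 0 < 1 - r by rewrite subr_gt0.
rewrite ler_pM2r ?invr_gt0 // ler_piMr // exprn_ile1 //; exact: ltW.
Qed.

Definition tailc (c r : R) : R := expR (c / (1 - r)) * (c / (1 - r)).

Lemma tailc_ge0 c r : 0 <= c -> 0 <= r < 1 -> 0 <= tailc c r.
Proof.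
move=> c0 /andP[r0 r1]; rewrite mulr_ge0 ?expR_ge0 // divr_ge0 // subr_ge0.
exact: ltW.
Qed.

(** Telescoping: the product minus one is the sum of the increments [v i] times
    the partial products, which are bounded by [norm_prod_le]. *)
Lemma norm_prod_sub1_le (c r : R) (v : nat -> C) (J m : nat) : 0 <= c -> 0 <= r < 1 ->
  (forall j, `|v j| <= emb (c * r ^+ j)) ->
  `|\prod_(J <= j < m) (1 + v j) - 1| <= emb (tailc c r * r ^+ J).
Proof.
move=> c0 r01 hv.
have [mJ|Jm] := leqP m J.
  rewrite big_geq // subrr normr0 -(rmorph0 emb) embE.
  by rewrite mulr_ge0 ?tailc_ge0 // exprn_ge0 //; case/andP: r01.
have -> : \prod_(J <= j < m) (1 + v j) - 1 =
    \sum_(J <= i < m) (\prod_(J <= j < i) (1 + v j)) * v i.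
  elim: m Jm => // m IH; rewrite ltnS leq_eqVlt => /orP[/eqP<-|Jm].
    by rewrite !big_nat1 big_geq // mul1r addrC addKr.
  rewrite [RHS]big_nat_recr ?(ltnW Jm) //= -IH // big_nat_recr ?(ltnW Jm) //=.
  by ring.
apply: le_trans (ler_norm_sum _ _ _) _.
apply: (@le_trans _ _
  (\sum_(J <= i < m) emb (expR (c / (1 - r)) * (c * r ^+ i)))).
  apply: ler_sum => i _; rewrite normrM rmorphM.
  by rewrite ler_pM ?normr_ge0 // norm_prod_le.
rewrite -rmorph_sum embE -mulr_sumr /tailc -!mulrA ler_wpM2l ?expR_ge0 //.
by rewrite [_^-1 * _]mulrC mulrA geometric_tail_le.
Qed.

(** * Convergence, continuity and zeros of theta *)

Variable p : C.
Hypothesis hp : `|p| < 1.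

Let r := nrm p.

Let r01 : 0 <= r < 1.
Proof. by rewrite -embE -embltE rmorph0 rmorph1 -normE normr_ge0. Qed.

Let norm_expp j : `|p ^+ j| = emb (r ^+ j).
Proof. by rewrite normrX normE rmorphXn. Qed.

Lemma cvg_norm_le (z : nat -> C) (l w : C) (b : R) m :
  (z @ \oo --> l)%classic -> (forall k, (m <= k)%N -> `|z k - w| <= emb b) ->
  `|l - w| <= emb b.
Proof.
move=> /cvgrPdist_lt zl zw.
rewrite normE embE; apply/ler_addgt0Pr => e e0; rewrite -embE -normE.
have e0' : (0 : C) < emb e by rewrite emb_gt0.
have [J _ HJ] := zl _ e0'.
have := HJ (maxn J m) (leq_maxl _ _) => /= lz.
have -> : `|l - w| = `|(z (maxn J m) - w) + (l - z (maxn J m))|.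
  by congr (`| _ |); ring.
apply: le_trans (ler_normD _ _) _.
by rewrite rmorphD lerD // ?zw ?leq_maxr // ltW.
Qed.

Definition theta_prod (a : C) (m : nat) : C :=
  \prod_(j < m) ((1 - a * p ^+ j) * (1 - p ^+ j.+1 / a)).

Let theta_dev (a : C) (j : nat) : C := (1 - a * p ^+ j) * (1 - p ^+ j.+1 / a) - 1.

Let theta_prodE a m : theta_prod a m = \prod_(0 <= j < m) (1 + theta_dev a j).
Proof.
rewrite big_mkord; apply: eq_bigr => j _.
by rewrite /theta_dev [RHS]addrC subrK.
Qed.

(** Bounding [a] and its inverse together controls both kinds of factors of
    theta. *)
Definition annulus (A : R) (a : C) :=
  [/\ a != 0, `|a| <= emb A & `|a^-1| <= emb A].

Lemma annulus_ge0 A a : annulus A a -> 0 <= A.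
Proof. by case=> _ h _; rewrite -emb_ge0; apply: le_trans h; rewrite normr_ge0. Qed.

Lemma in_annulus a : a != 0 -> annulus (nrm a + nrm a^-1) a.
Proof.
move=> a0; split => //; rewrite rmorphD.
  by rewrite -!normE lerDl.
by rewrite -!normE lerDr.
Qed.

Let vconst (A : R) : R := 2 * A + 1.

Let vconst_ge0 A a : annulus A a -> 0 <= vconst A.
Proof. by move/annulus_ge0 => A0; rewrite addr_ge0 ?mulr_ge0. Qed.

Let v_le A a j : annulus A a -> `|theta_dev a j| <= emb (vconst A * r ^+ j).
Proof.
move=> Ha; have [a0 aA aA'] := Ha; have A0 := annulus_ge0 Ha.
have [r0 r1] := andP r01.
have -> : theta_dev a j = - (a * p ^+ j) + (- (p ^+ j.+1 * a^-1) + p ^+ j * p ^+ j.+1).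
  by rewrite /theta_dev; field.
have rS : r ^+ j.+1 <= r ^+ j by rewrite exprS ler_piMl ?exprn_ge0 // ltW.
apply: (@le_trans _ _ (emb (A * r ^+ j + (A * r ^+ j + r ^+ j)))); last first.
  by rewrite embE /vconst; lra.
rewrite !rmorphD; apply: le_trans (ler_normD _ _) _; apply: lerD.
  by rewrite normrN normrM norm_expp rmorphM ler_wpM2r // emb_ge0 exprn_ge0.
apply: le_trans (ler_normD _ _) _; apply: lerD.
  rewrite normrN normrM mulrC norm_expp rmorphM ler_pM ?normr_ge0 //.
    by rewrite emb_ge0 exprn_ge0.
  by rewrite embE.
rewrite normrM !norm_expp -rmorphM embE ler_piMr ?exprn_ge0 //.
by rewrite exprn_ile1 // ltW.
Qed.

Let rate (A : R) : R := expR (vconst A / (1 - r)) * tailc (vconst A) r.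

Let theta_prod_cauchy A a m k : annulus A a -> (m <= k)%N ->
  `|theta_prod a k - theta_prod a m| <= emb (rate A * r ^+ m).
Proof.
move=> Ha mk; rewrite !theta_prodE (big_cat_nat _ mk) //=.
set P := (X in X * _ - _); set Q := (X in _ * X - _).
have -> : P * Q - P = P * (Q - 1) by ring.
rewrite normrM /rate -mulrA rmorphM ler_pM ?normr_ge0 //.
  by apply: norm_prod_le => // [|j]; [exact: vconst_ge0 Ha|exact: v_le].
by apply: norm_prod_sub1_le => // [|j]; [exact: vconst_ge0 Ha|exact: v_le].
Qed.

Lemma theta_prod_cvg a : a != 0 -> (theta_prod a @ \oo --> theta p a)%classic.
Proof.
move=> a0; have Ha := in_annulus a0.
have [l hl] := geometric_complete r01
  (fun m k => @theta_prod_cauchy _ _ m k Ha).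
by rewrite /theta (cvg_lim _ hl).
Qed.

Let theta_prod_rate A a m : annulus A a ->
  `|theta p a - theta_prod a m| <= emb (rate A * r ^+ m).
Proof.
move=> Ha; have a0 : a != 0 by case: Ha.
apply: (@cvg_norm_le (theta_prod a) _ _ _ m (theta_prod_cvg a0)) => k mk.
exact: (theta_prod_cauchy Ha mk).
Qed.

Let nbhs_self_cvg (c : C) : ((fun t : C => t) @ c --> c)%classic.
Proof. by move=> B. Qed.

Let nbhs_cst_cvg (c k : C) : ((fun _ : C => k) @ c --> k)%classic.
Proof. exact: (@cvg_cst _ _ _ (nbhs c) (nbhs_filter c)). Qed.

Let nbhs_cvgP (f : C -> C) (c l : C) : (f @ c --> l)%classic <->
  (forall e, 0 < e -> \forall t \near nbhs c, `|l - f t| < e)%classic.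
Proof. exact: (@cvgrPdist_lt _ _ _ _ (nbhs_filter c)). Qed.

Lemma theta_prod_continuous (c : C) m : c != 0 ->
  (theta_prod t m @[t --> c] --> theta_prod c m)%classic.
Proof.
move=> c0; rewrite /theta_prod; elim: m => [|m IH].
  have -> : (fun t : C => \prod_(j < 0) ((1 - t * p ^+ j) * (1 - p ^+ j.+1 / t))) =
      (fun=> 1) by apply/funext => t; rewrite big_ord0.
  by rewrite big_ord0; exact: (@nbhs_cst_cvg c).
have -> : (fun t : C => \prod_(j < m.+1) ((1 - t * p ^+ j) * (1 - p ^+ j.+1 / t)))
  = (fun t => theta_prod t m * ((1 - t * p ^+ m) * (1 - p ^+ m.+1 / t))).
  by apply/funext => t; rewrite big_ord_recr.
rewrite big_ord_recr /=.
apply: cvgM IH _; apply: cvgM.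
  by apply: cvgB; [exact: (@nbhs_cst_cvg c)|apply: cvgMl; exact: (@nbhs_self_cvg c)].
apply: cvgB; first exact: (@nbhs_cst_cvg c).
by apply: cvgMr; apply: cvgV => //; exact: (@nbhs_self_cvg c).
Qed.

Lemma near_annulus (c : C) : c != 0 ->
  exists A, (\forall t \near nbhs c, annulus A t)%classic.
Proof.
move=> c0; exists (nrm c + nrm c^-1 + 1).
have [_ h1 h2] := in_annulus c0.
have H1 := (nbhs_cvgP _ _ _).1 (@nbhs_self_cvg c) 1 ltr01.
have H2 := (nbhs_cvgP _ _ _).1 (@cvgV _ _ _ (nbhs_filter c) _ _ c0 (@nbhs_self_cvg c)) 1 ltr01.
have H3 : (\forall t \near nbhs c, t != 0)%classic.
  exact: (@cvgr_neq0 _ _ _ _ (nbhs_filter c) _ _ (@nbhs_self_cvg c) c0).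
near=> t.
have H1t : `|c - t| < 1 by near: t.
have H2t : `|c^-1 - t^-1| < 1 by near: t.
split; first by near: t.
  have -> : t = c - (c - t) by ring.
  apply: le_trans (ler_normB _ _) _; rewrite rmorphD rmorph1; apply: lerD => //; exact: ltW.
have -> : t^-1 = c^-1 - (c^-1 - t^-1) by ring.
apply: le_trans (ler_normB _ _) _; rewrite rmorphD rmorph1; apply: lerD => //; exact: ltW.
Unshelve. all: by end_near.
Qed.

(** The partial products are continuous and, by [theta_prod_rate], converge
    uniformly on annuli. *)
Lemma theta_continuous (c : C) : c != 0 ->
  (theta p t @[t --> c] --> theta p c)%classic.
Proof.
move=> c0; have [A HA] := near_annulus c0.
have Hc : annulus A c := nbhs_singleton HA.
apply/nbhs_cvgP => e e0.
have [e' e'0 ee'] : exists2 e' : R, 0 < e' & e = emb (e' + (e' + e')).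
  have [a a0 ->] := embP e0.
  by exists (a / 3); [rewrite divr_gt0|congr (emb _); field].
have [m Hm] := geometric_small (rate A) r01 e'0.
have /nbhs_cvgP /(_ (emb e')) Hcont := @theta_prod_continuous c m c0.
have e'0' : (0 : C) < emb e' by rewrite emb_gt0.
have {}Hcont := Hcont e'0'.
near=> t.
have Ht : annulus A t by near: t.
have -> : theta p c - theta p t = (theta p c - theta_prod c m) +
  ((theta_prod c m - theta_prod t m) - (theta p t - theta_prod t m)) by ring.
have small b : annulus A b -> `|theta p b - theta_prod b m| < emb e'.
  by move=> Hb; apply: le_lt_trans (theta_prod_rate m Hb) _; rewrite embltE Hm.
rewrite ee' !rmorphD; apply: le_lt_trans (ler_normD _ _) _.
apply: ltrD; first exact: small.
apply: le_lt_trans (ler_normB _ _) _; apply: ltrD; last exact: small.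
by near: t.
Unshelve. all: by end_near.
Qed.

(** Beyond some index the remaining factors have a product close to 1, so a zero
    of theta is a zero of one of finitely many factors. *)
Let theta_eq0_prod A : exists J, forall a, annulus A a ->
  theta p a = 0 -> theta_prod a J = 0.
Proof.
have h0 : 0 < (1 / 2 : R) by rewrite divr_gt0.
have [J HJ] := geometric_small (tailc (vconst A) r) r01 h0.
exists J => a Ha th0; have a0 : a != 0 by case: Ha.
have := theta_prod_cvg a0; rewrite th0 => hcv.
apply/eqP; rewrite -normr_le0; set P := theta_prod a J.
have bnd k : (J <= k)%N -> `|theta_prod a k - P| <= `|P| * emb (1 / 2 : R).
  move=> Jk; rewrite /P !theta_prodE (big_cat_nat _ Jk) //=.
  set P' := (X in X * _ - _); set Q := (X in _ * X - _).
  have -> : P' * Q - P' = P' * (Q - 1) by ring.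
  rewrite normrM ler_wpM2l //.
  apply: le_trans (norm_prod_sub1_le _ _ _ r01 (fun j => v_le j Ha)) _.
    exact: vconst_ge0 Ha.
  by rewrite embE ltW // HJ.
have : `|0 - P| <= emb (nrm P * (1 / 2)).
  apply: (@cvg_norm_le (theta_prod a) _ _ _ J hcv) => k Jk.
   rewrite rmorphM -normE; exact: bnd.
rewrite sub0r normrN normE embE => h.
by rewrite -[X in _ <= X](rmorph0 emb) embE; lra.
Qed.

Lemma near_neq_seq (c : C) (s : seq C) :
  (\forall t \near c^', t \notin s)%classic.
Proof.
elim: s => [|u s IH]; first by near=> t.
have Hu : (\forall t \near c^', t != u)%classic.
  have [->|uc] := eqVneq u c.
    by apply: (@filterE _ _ (nbhs_filter c)) => t /=.
  apply: nbhs_dnbhs.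
  have /cvgr_neq0 : ((fun t : C => t - u) @ c --> c - u)%classic.
    exact: (@cvgB _ _ _ _ (nbhs_filter c) _ _ _ _ (@nbhs_self_cvg c) (@nbhs_cst_cvg c u)).
  rewrite subr_eq0 eq_sym => /(_ uc); apply: filterS => t.
  by rewrite subr_eq0.
near=> t; rewrite inE negb_or; apply/andP; split; by near: t.
Unshelve. all: by end_near.
Qed.

Lemma theta_near_neq0 (c : C) : c != 0 ->
  (\forall t \near c^', theta p t != 0)%classic.
Proof.
move=> c0; have [A HA] := near_annulus c0.
have [J HJ] := theta_eq0_prod A.
pose s := [seq (p ^+ j)^-1 | j <- iota 0 J] ++ [seq p ^+ j.+1 | j <- iota 0 J].
have Hs := near_neq_seq c s.
have HA' : (\forall t \near c^', annulus A t)%classic.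
  exact: nbhs_dnbhs HA.
near=> t.
have Ht : annulus A t by near: t.
have t0 : t != 0 by case: Ht.
have : t \notin s by near: t.
apply: contra => /eqP /(HJ t Ht) /eqP; rewrite /theta_prod.
rewrite prodf_seq_eq0 => /hasP[j _ /=].
have ij : (j : nat) \in iota 0 J by rewrite mem_iota add0n /= ltn_ord.
rewrite mulf_eq0 mem_cat => /orP[].
  rewrite subr_eq0 => /eqP h; apply/orP; left; apply/mapP; exists (j : nat) => //.
  have pj0 : p ^+ j != 0.
    by apply: contra_eq_neq h => ->; rewrite mulr0 oner_eq0.
  by rewrite -[RHS]mul1r h mulfK.
rewrite subr_eq0 => /eqP h; apply/orP; right; apply/mapP; exists (j : nat) => //.
by rewrite -[LHS]mul1r h divfK.
Unshelve. all: by end_near.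
Qed.

Lemma exprp_cvg0 : ((fun m => p ^+ m) @ \oo --> (0 : C))%classic.
Proof.
apply/cvgrPdist_lt => e e0.
have [e' e'0 ee'] := embP e0.
have [m Hm] := geometric_small 1 r01 e'0.
exists m => // k /= mk; rewrite sub0r normrN norm_expp ee' embltE -[_ ^+ _]mul1r.
exact: Hm.
Qed.

(** Inverting [a] shifts the two families of factors against each other, which
    costs one factor at each end of the truncated product. *)
Lemma thetaV a : a != 0 -> theta p a^-1 = - a^-1 * theta p a.
Proof.
move=> a0; have aV0 : a^-1 != 0 by rewrite invr_neq0.
have E m : a * (1 - p ^+ m * a^-1) * theta_prod a^-1 m =
    - ((1 - a * p ^+ m) * theta_prod a m).
  elim: m => [|m IH]; first by rewrite /theta_prod !big_ord0 !expr0; field.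
  have S b : theta_prod b m.+1 =
      theta_prod b m * ((1 - b * p ^+ m) * (1 - p ^+ m.+1 / b)).
    by rewrite /theta_prod big_ord_recr.
  rewrite !S invrK.
  transitivity ((a * (1 - p ^+ m * a^-1) * theta_prod a^-1 m)
    * ((1 - p ^+ m.+1 / a) * (1 - a * p ^+ m.+1))); first by ring.
  by rewrite IH; ring.
have L1 : ((fun m => a * (1 - p ^+ m * a^-1) * theta_prod a^-1 m) @ \oo
    --> a * (1 - 0 * a^-1) * theta p a^-1)%classic.
  apply: cvgM (theta_prod_cvg aV0); apply: cvgMr.
  by apply: cvgB; [apply: cvg_cst|apply: cvgMl; exact: exprp_cvg0].
have L2 : ((fun m => - ((1 - a * p ^+ m) * theta_prod a m)) @ \oo
    --> - ((1 - a * 0) * theta p a))%classic.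
  apply: cvgN; apply: cvgM (theta_prod_cvg a0).
  by apply: cvgB; [apply: cvg_cst|apply: cvgMr; exact: exprp_cvg0].
rewrite (eq_cvg _ _ E) in L1.
have := cvg_unique _ L1 L2.
rewrite mul0r mulr0 !subr0 mulr1 mul1r => /(_ (@norm_hausdorff _ _)) e.
by apply: (mulfI a0); rewrite e mulrA mulrN mulfV // mulN1r.
Qed.

(** * The finite triple product *)

(** The products [(1 - p^(J+1)) ... (1 - p^m)]; [euler 0 m] is the shifted
    factorial (p; p)_m. *)
Definition euler (J m : nat) : C := \prod_(J <= j < m) (1 + - p ^+ j.+1).

Let euler_le j : `|- p ^+ j.+1 : C| <= emb (1 * r ^+ j).
Proof.
have [r0 r1] := andP r01.
by rewrite normrN norm_expp embE mul1r exprS ler_piMl ?exprn_ge0 // ltW.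
Qed.

Let M : R := expR (1 / (1 - r)).
Let T : R := tailc 1 r.

Let norm_euler J m : `|euler J m| <= emb M.
Proof. by apply: norm_prod_le. Qed.

Let norm_euler1 J m : `|euler J m - 1| <= emb (T * r ^+ J).
Proof. by apply: norm_prod_sub1_le. Qed.

Lemma euler_cat I m : (I <= m)%N -> euler 0 m = euler 0 I * euler I m.
Proof. by move=> h; rewrite /euler (big_cat_nat _ h). Qed.

Lemma euler_neq0 J m : euler J m != 0.
Proof.
rewrite /euler prodf_seq_neq0; apply/allP => j _ /=.
rewrite subr_eq0 eq_sym; apply/eqP => h.
have : emb (r ^+ j.+1) < 1.
  by have [r0 r1] := andP r01; rewrite -(rmorph1 emb) embltE exprn_ilt1.
by rewrite -norm_expp h normr1 ltxx.
Qed.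

Lemma euler_cvg : exists2 phi : C, phi != 0 & (euler 0 @ \oo --> phi)%classic.
Proof.
have cau m k : (m <= k)%N ->
    `|euler 0 k - euler 0 m| <= `|euler 0 m| * emb (T * r ^+ m).
  move=> mk; rewrite (euler_cat mk) -{2}[euler 0 m]mulr1 -mulrBr normrM.
  by rewrite ler_wpM2l.
have cau' m k : (m <= k)%N ->
    `|euler 0 k - euler 0 m| <= emb (M * T * r ^+ m).
  move=> /cau h; apply: le_trans h _; rewrite -[M * T * _]mulrA (rmorphM emb M) ler_wpM2r //.
  by rewrite emb_ge0 mulr_ge0 ?tailc_ge0 ?exprn_ge0 //; case/andP: r01.
have [phi hphi] := geometric_complete r01 cau'; exists phi => //.
have h0 : 0 < (1 / 2 : R) by rewrite divr_gt0.
have [J HJ] := geometric_small T r01 h0.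
apply/eqP => phi0; have /negP := euler_neq0 0 J; apply.
have : `|phi - euler 0 J| <= emb (nrm (euler 0 J) * (1 / 2)).
  apply: (@cvg_norm_le (euler 0) _ _ _ J hphi) => k Jk.
  apply: le_trans (cau _ _ Jk) _; rewrite (rmorphM emb (nrm (euler 0 J))) -normE ler_wpM2l //.
  by rewrite embE ltW // HJ.
rewrite phi0 sub0r normrN normE embE => h.
by rewrite -normr_le0 normE -[X in _ <= X](rmorph0 emb) embE; lra.
Qed.

(** The Gaussian binomial coefficients in base [p]. *)
Fixpoint qbin (m k : nat) : C :=
  match m, k with
  | _, 0 => 1
  | 0, _.+1 => 0
  | m.+1, k.+1 => qbin m k.+1 + p ^+ (m - k) * qbin m k
  end.

Lemma qbin0 m : qbin m 0 = 1. Proof. by case: m. Qed.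

Lemma qbin_small m k : (m < k)%N -> qbin m k = 0.
Proof.
elim: m k => [|m IH] [|k] //; rewrite ltnS => mk /=.
by rewrite !IH ?mulr0 ?addr0 // ltnW.
Qed.

Lemma eulerS m : euler 0 m.+1 = euler 0 m * (1 - p ^+ m.+1).
Proof. by rewrite /euler big_nat_recr. Qed.

Lemma euler0 : euler 0 0 = 1.
Proof. by rewrite /euler big_geq. Qed.

Lemma qbin_euler m k : (k <= m)%N ->
  qbin m k * (euler 0 k * euler 0 (m - k)) = euler 0 m.
Proof.
elim: m k => [|m IH] [|k]; rewrite ?euler0 ?mul1r ?subn0 //=.
rewrite ltnS subSS => km.
have [->|km'] := eqVneq k m.
  have := IH m (leqnn m); rewrite subnn euler0 mulr1 => e.
  by rewrite qbin_small // add0r expr0 mul1r mulr1 !eulerS mulrA e.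
have {}km' : (k < m)%N by rewrite ltn_neqAle km'.
have e : (m - k = (m - k.+1).+1)%N by lia.
transitivity ((qbin m k.+1 * (euler 0 k.+1 * euler 0 (m - k.+1)))
    * (1 - p ^+ (m - k)) + p ^+ (m - k) * (1 - p ^+ k.+1) *
  (qbin m k * (euler 0 k * euler 0 (m - k)))).
  rewrite mulrDl; congr (_ + _); last by rewrite eulerS; ring.
  by rewrite e (eulerS (m - k.+1)); ring.
rewrite !IH // eulerS.
have -> : p ^+ m.+1 = p ^+ (m - k) * p ^+ k.+1 by rewrite -exprD; congr (_ ^+ _); lia.
by ring.
Qed.

Lemma q_binomial m (z : C) :
  \prod_(j < m) (1 - z * p ^+ j) =
  \sum_(k < m.+1) qbin m k * ((-1) ^+ k * p ^+ 'C(k, 2) * z ^+ k).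
Proof.
elim: m => [|m IH]; first by rewrite big_ord0 big_ord1 /= expr0; ring.
pose f i k := qbin i k * ((-1) ^+ k * p ^+ 'C(k, 2) * z ^+ k).
have {}IH : \prod_(j < m) (1 - z * p ^+ j) = \sum_(k < m.+1) f m k := IH.
rewrite big_ord_recr /= IH -(big_mkord xpredT (f m.+1)) big_nat_recl // big_mkord.
have fS (k : 'I_m.+1) : f m.+1 k.+1 = f m k.+1 - f m k * (z * p ^+ m).
  rewrite /f /= binS bin1 exprD.
  have km : (k <= m)%N by rewrite -ltnS.
  have -> : p ^+ m = p ^+ (m - k) * p ^+ k by rewrite -exprD subnK.
  by rewrite !exprS; ring.
rewrite (eq_bigr _ (fun k _ => fS k)) sumrB -mulr_suml.
have fm : f m m.+1 = 0 by rewrite /f qbin_small ?mul0r.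
rewrite [X in _ = _ + (X - _)]big_ord_recr /= fm addr0.
have -> : \sum_(k < m.+1) f m k = 1 + \sum_(i < m) f m i.+1.
  rewrite -(big_mkord xpredT (f m)) big_nat_recl // big_mkord.
  by congr (_ + _); rewrite /f qbin0 expr0 bin0n /=; ring.
have -> : f m.+1 0 = 1 by rewrite /f qbin0 expr0 bin0n /=; ring.
by ring.
Qed.

Section AdditionFormula.
(* The recentered expansion involves negative powers of [p]; for [p = 0] the
   addition formula is an identity of rational functions. *)
Hypothesis pn0 : p != 0.

Let r_gt0 : 0 < r. Proof. by rewrite -emb_gt0 -normE normr_gt0. Qed.

(** The exponent [n (n - 1) / 2], as a natural number for every integer [n]. *)
Definition tri (n : int) : nat :=
  match n with Posz k => 'C(k, 2) | Negz k => 'C(k.+2, 2) end.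

Lemma tri2 n : (tri n)%:Z * 2 = n * (n - 1).
Proof.
have H k : ('C(k.+1, 2) * 2 = k.+1 * k)%N.
  by elim: k => // k IH; rewrite binS bin1 mulnDl IH; lia.
case: n => [[|k]|k] //=; last by have := H k.+1; lia.
by have := H k; lia.
Qed.

(** The general term of the Jacobi theta series. *)
Definition jterm (a : C) (n : int) : C := (-1) ^ n * p ^+ tri n * a ^ n.

Lemma jterm0 a : jterm a 0 = 1.
Proof. by rewrite /jterm !expr0z expr0 !mulr1. Qed.

Let triE n : p ^+ tri n = p ^ (tri n)%:Z. Proof. by []. Qed.

Lemma jtermS a n : a != 0 -> jterm a (n + 1) = - a * p ^ n * jterm a n.
Proof.
move=> a0; have e : (tri (n + 1))%:Z = (tri n)%:Z + n.
  have h1 := tri2 (n + 1); have h2 := tri2 n.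
  apply: (@mulIf _ 2) => //; rewrite h1 [RHS]mulrDl h2; ring.
rewrite /jterm !triE e !expfzDr ?oppr_eq0 ?oner_neq0 // !expr1z; ring.
Qed.

(** The q-binomial theorem with [2 m] factors at [z = a / p^m]: the first [m]
    factors are, up to a monomial, the factors [1 - p^(l+1) / a] of theta. *)
Lemma triple_product a m : a != 0 ->
  theta_prod a m = \sum_(k < (m + m).+1) qbin (m + m) k * jterm a (k%:Z - m%:Z).
Proof.
move=> a0; pose c k : C := \prod_(l < k) (- a / p ^+ l.+1).
have pX k : p ^+ k != 0 by rewrite expf_neq0.
have c0 k : c k != 0.
  rewrite /c; apply/prodf_neq0 => l _.
  by rewrite mulf_neq0 ?oppr_eq0 ?invr_neq0.
have cj k : c k * jterm a (- k%:Z) = 1.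
  elim: k => [|k IH]; first by rewrite /c big_ord0 mul1r oppr0 jterm0.
  rewrite -[RHS]IH /c big_ord_recr /= -/(c k) -!mulrA; congr (_ * _).
  have -> : - k%:Z = - k.+1%:Z + 1 by lia.
  by rewrite jtermS // -exprnN !mulrA.
have E (k : nat) : (-1) ^+ k * p ^+ 'C(k, 2) * (a / p ^+ m) ^+ k =
    c m * jterm a (k%:Z - m%:Z).
  elim: k => [|k IH]; first by rewrite sub0r cj !expr0 !mulr1.
  have -> : k.+1%:Z - m%:Z = (k%:Z - m%:Z) + 1 by lia.
  rewrite jtermS // mulrCA -IH binS bin1 exprD !exprS expfzDr // -exprnN.
  by rewrite -exprnP; ring.
have L : \prod_(j < m + m) (1 - a / p ^+ m * p ^+ j) = c m * theta_prod a m.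
  rewrite big_split_ord /= /theta_prod big_split /= mulrCA mulrC.
  congr (_ * _).
    by apply: eq_bigr => j _; rewrite exprD mulrA divfK.
  rewrite (reindex_inj rev_ord_inj) /= /c -big_split /=; apply: eq_bigr => j _.
  have -> : p ^+ m = p ^+ (m - j.+1) * p ^+ j.+1 by rewrite -exprD subnK.
  by field; rewrite a0 !pX.
apply: (mulfI (c0 m)); rewrite -L q_binomial mulr_sumr; apply: eq_bigr => k _.
by rewrite E; ring.
Qed.

(** The two families of Gaussian terms into which the double series splits,
    according to the parity of [i + j]. *)
Definition gauss0 (u : int) (x : C) : C := p ^ (u * u) * x ^ (u * 2).
Definition gauss1 (v : int) (x : C) : C := p ^ (v * v + v) * x ^ (v * 2 + 1).

Let sign_cancel (i j k : int) : i + j = k + k -> (-1 : C) ^ i * (-1) ^ j = 1.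
Proof.
move=> e; have h : (-1 : C) != 0 by rewrite oppr_eq0 oner_neq0.
by rewrite -expfzDr // e expfzDr // -expfzMl mulrNN mulr1 exp1rz.
Qed.

Let power_split (x y : C) (i j : int) : x != 0 -> y != 0 ->
  (x * y) ^ i * (x / y) ^ j = x ^ (i + j) * y ^ (i - j).
Proof.
move=> x0 y0; rewrite !expfzMl !expfzDr // exprz_inv; ring.
Qed.

(** For [i = u + 1 + v] and [j = u + 1 - v] the sum [tri i + tri j] is a function
    of [u] plus a function of [v].  This separation is the source of the addition
    formula. *)
Lemma jterm_mul_even x y u v : x != 0 -> y != 0 ->
  jterm (x * y) (u + 1 + v) * jterm (x / y) (u + 1 - v) =
  x * (gauss1 u x * gauss0 v y).
Proof.
move=> x0 y0; rewrite /jterm /gauss0 /gauss1 !triE.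
set i := u + 1 + v; set j := u + 1 - v.
have e : (tri i)%:Z + (tri j)%:Z = (u * u + u) + v * v.
  apply: (@mulIf _ 2) => //; rewrite mulrDl !tri2 /i /j; ring.
have s : (-1 : C) ^ i * (-1) ^ j = 1.
  by apply: (@sign_cancel _ _ (u + 1)); rewrite /i /j; ring.
transitivity (((-1 : C) ^ i * (-1) ^ j) * (p ^ (tri i)%:Z * p ^ (tri j)%:Z) *
  ((x * y) ^ i * (x / y) ^ j)); first by ring.
rewrite s power_split // -expfzDr // e.
have -> : i + j = (u * 2 + 1) + 1 by rewrite /i /j; ring.
have -> : i - j = v * 2 by rewrite /i /j; ring.
by rewrite (expfzDr _ 1 x0) (expfzDr _ (v * v) pn0) expr1z; ring.
Qed.

Lemma jterm_mul_odd x y u v : x != 0 -> y != 0 ->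
  jterm (x * y) (u + v + 1) * jterm (x / y) (u - v) =
  - (x * (gauss0 u x * gauss1 v y)).
Proof.
move=> x0 y0; rewrite /jterm /gauss0 /gauss1 !triE.
set i := u + v + 1; set j := u - v.
have e : (tri i)%:Z + (tri j)%:Z = u * u + (v * v + v).
  apply: (@mulIf _ 2) => //; rewrite mulrDl !tri2 /i /j; ring.
have s : (-1 : C) ^ i * (-1) ^ j = -1.
  have -> : i = (u + v) + 1 by [].
  rewrite expfzDr ?oppr_eq0 ?oner_neq0 // expr1z mulrAC.
  by rewrite (@sign_cancel _ _ u) ?mul1r // /j; ring.
transitivity (((-1 : C) ^ i * (-1) ^ j) * (p ^ (tri i)%:Z * p ^ (tri j)%:Z) *
  ((x * y) ^ i * (x / y) ^ j)); first by ring.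
rewrite s power_split // -expfzDr // e.
have -> : i + j = u * 2 + 1 by rewrite /i /j; ring.
have -> : i - j = v * 2 + 1 by rewrite /i /j; ring.
by rewrite (expfzDr (u * 2) 1 x0) (expfzDr (u * u) _ pn0) expr1z; ring.
Qed.

(** The coefficient of [jterm a i] in [(p; p)_(2 m)] times the truncated theta
    product.  It tends to 1 as [m] grows, with an error governed by the distance
    of [i] to the ends of the range ([qcoef_near1]). *)
Definition qcoef (m : nat) (i : int) : C :=
  match i + m%:Z with
  | Posz k => euler 0 (m + m) * qbin (m + m) k
  | Negz _ => 0
  end.

Lemma qcoef_out m i : (m < `|i|)%N -> qcoef m i = 0.
Proof.
move=> h; rewrite /qcoef; case E : (i + m%:Z) => [k|//].
by rewrite qbin_small ?mulr0 //; lia.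
Qed.

(** The quotient of shifted factorials defining the Gaussian binomial leaves two
    tails of the Euler product, both starting beyond [m - |i|]. *)
Lemma qcoef_in m i : (`|i| <= m)%N ->
  exists I J : nat, [/\ qcoef m i = euler I (m + m) * euler J (m + m),
    (m - `|i| <= I)%N & (m - `|i| <= J)%N].
Proof.
move=> h; rewrite /qcoef; case E : (i + m%:Z) => [k|k]; last by lia.
exists k, (m + m - k)%N; split; [|lia|lia].
have km : (k <= m + m)%N by lia.
have e0 := euler_neq0 0 k; have e1 := euler_neq0 0 (m + m - k).
apply: (mulIf e0); apply: (mulIf e1).
transitivity (euler 0 (m + m) * (qbin (m + m) k *
  (euler 0 k * euler 0 (m + m - k)))); first by ring.
rewrite qbin_euler // {1}(euler_cat km).
have km' : (m + m - k <= m + m)%N by lia.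
by rewrite {1}(euler_cat km'); ring.
Qed.

(** The factor [r^s] compensates the loss of precision near the ends of the range,
    and outside of it, where the coefficients vanish.  It will be absorbed by the
    Gaussian decay of the terms. *)
Lemma qcoef_near1 : exists2 K : R, 0 <= K & forall m i j s,
  (`|i| <= s)%N -> (`|j| <= s)%N ->
  `|qcoef m i * qcoef m j - 1| * emb (r ^+ s) <= emb (K * r ^+ m).
Proof.
have [r0 r1] := andP r01.
have T0 : 0 <= T by apply: tailc_ge0.
have M0 : 0 <= M by apply: expR_ge0.
have rX0 k : 0 <= r ^+ k by rewrite exprn_ge0.
have anti a b : (a <= b)%N -> r ^+ b <= r ^+ a.
  by move=> ab; apply: ler_wiXn2l => //; exact: ltW.
pose K1 := M * T + T.
have K10 : 0 <= K1 by apply: addr_ge0 => //; apply: mulr_ge0.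
have mul_near1 (u w : C) (A B : R) : `|u| <= emb A -> 0 <= A -> 0 <= B ->
    forall e, 0 <= e -> `|w - 1| <= emb (B * e) -> `|u - 1| <= emb (B * e) ->
    `|u * w - 1| <= emb ((A * B + B) * e).
  move=> uA A0 B0 e e0 wB uB.
  have -> : u * w - 1 = u * (w - 1) + (u - 1) by ring.
  apply: le_trans (ler_normD _ _) _; rewrite mulrDl rmorphD lerD //.
  by rewrite normrM -mulrA rmorphM ler_pM.
have near1 m i : (`|i| <= m)%N ->
    `|qcoef m i - 1| <= emb (K1 * r ^+ (m - `|i|)) /\
    `|qcoef m i| <= emb (M * M).
  move=> im; have [I [J [-> hI hJ]]] := qcoef_in im; split; last first.
    by rewrite normrM rmorphM ler_pM.
  apply: mul_near1 => //.
    apply: le_trans (norm_euler1 _ _) _.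
    by rewrite embE ler_wpM2l // anti.
  apply: le_trans (norm_euler1 _ _) _.
  by rewrite embE ler_wpM2l // anti.
exists (M * M * K1 + K1 + 1) => [|m i j s si sj].
  do 2![apply: addr_ge0 => //]; do 2![apply: mulr_ge0 => //].
have [im|im] := leqP `|i| m; have [jm|jm] := leqP `|j| m; last first.
- rewrite qcoef_out // mul0r sub0r normrN normr1 mul1r embE.
  apply: le_trans (anti m s _) _; first exact: ltnW (leq_trans im si).
  by rewrite ler_peMl // lerDr addr_ge0 ?mulr_ge0.
- rewrite qcoef_out // mul0r sub0r normrN normr1 mul1r embE.
  apply: le_trans (anti m s _) _; first exact: ltnW (leq_trans im si).
  by rewrite ler_peMl // lerDr addr_ge0 ?mulr_ge0.
- rewrite (qcoef_out jm) mulr0 sub0r normrN normr1 mul1r embE.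
  apply: le_trans (anti m s _) _; first exact: ltnW (leq_trans jm sj).
  by rewrite ler_peMl // lerDr addr_ge0 ?mulr_ge0.
have [hi bi] := near1 m i im; have [hj bj] := near1 m j jm.
have KK0 : 0 <= M * M * K1 + K1.
  by apply: addr_ge0 => //; do 2![apply: mulr_ge0 => //].
pose t := (m - maxn `|i| `|j|)%N.
have h : `|qcoef m i * qcoef m j - 1| <= emb ((M * M * K1 + K1) * r ^+ t).
  apply: mul_near1 => //; rewrite ?mulr_ge0 //.
    by apply: le_trans hj _; rewrite embE ler_wpM2l // anti // leq_sub2l // leq_maxr.
  by apply: le_trans hi _; rewrite embE ler_wpM2l // anti // leq_sub2l // leq_maxl.
apply: (@le_trans _ _ (emb ((M * M * K1 + K1) * r ^+ t) * emb (r ^+ s))).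
  by rewrite ler_wpM2r // emb_ge0.
rewrite -rmorphM embE -mulrA -exprD.
apply: (@le_trans _ _ ((M * M * K1 + K1) * r ^+ m)).
  have ms : (maxn `|i| `|j| <= s)%N by rewrite geq_max si.
  have tm : (m <= t + s)%N.
    by apply: leq_trans (leq_add (leqnn t) ms); rewrite addnC -maxnE leq_maxr.
  by rewrite ler_wpM2l // anti.
by rewrite ler_wpM2r // lerDl.
Qed.

Lemma half_sum (c L : nat) : \sum_(k < L) (1 / 2 : R) ^+ `|k%:Z - c%:Z| <= 3.
Proof.
pose f (k : nat) : R := (1 / 2) ^+ `|k%:Z - c%:Z|.
have f0 k : 0 <= f k by rewrite exprn_ge0 // divr_ge0.
have H1 k : (k <= c)%N -> \sum_(0 <= i < k) f i <= f k.
  elim: k => [|k IH] kc; first by rewrite big_geq.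
  rewrite big_nat_recr //=; apply: le_trans (lerD (IH (ltnW kc)) (lexx _)) _.
  have -> : f k = f k.+1 / 2; last by lra.
  have e : (`|k%:Z - c%:Z| = (`|k.+1%:Z - c%:Z|).+1)%N by lia.
  by rewrite /f e exprS; field.
have H2 k : \sum_(0 <= i < c + k) f i <= 3 - 2 * (1 / 2) ^+ k.
  elim: k => [|k IH].
    rewrite addn0 expr0; apply: le_trans (H1 c (leqnn _)) _.
    by rewrite /f subrr expr0; lra.
  rewrite addnS big_nat_recr //=; apply: le_trans (lerD IH (lexx _)) _.
  have e : (`|(c + k)%:Z - c%:Z| = k)%N by lia.
  by rewrite /f e exprS; lra.
rewrite -(big_mkord xpredT f); have [Lc|cL] := leqP L c.
  have : f L <= 1 by rewrite exprn_ile1 //; lra.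
  by have := H1 L Lc; lra.
have := H2 (L - c)%N; rewrite (subnKC (ltnW cL)) => h; apply: le_trans h _.
by rewrite lerBlDr lerDl mulr_ge0 // exprn_ge0 // divr_ge0.
Qed.

(** Once [r^k c <= 1/2] the left side is at most [(1/2)^k]; the constant covers the
    finitely many smaller [k]. *)
Let gauss_decay (c : R) : 1 <= c ->
  exists2 B : R, 0 <= B & forall k, (r ^+ k * c) ^+ k <= B * (1 / 2) ^+ k.
Proof.
move=> c1; have [r0 r1] := andP r01.
have h0 : 0 < (1 / 2 : R) by rewrite divr_gt0.
have [J HJ] := geometric_small c r01 h0.
have c0 : 0 <= c by apply: le_trans c1.
exists ((2 * c) ^+ J) => [|k]; first by rewrite exprn_ge0 // mulr_ge0.
have two1 : 1 <= 2 * c by lra.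
have [Jk|kJ] := leqP J k.
  apply: (@le_trans _ _ ((1 / 2) ^+ k)).
    have h : r ^+ k * c <= 1 / 2 by rewrite mulrC ltW // HJ.
    by apply: lerXn2r => //; rewrite nnegrE ?mulr_ge0 ?exprn_ge0 // ltW.
  rewrite ler_peMl ?exprn_ge0 ?(ltW h0) //; exact: exprn_ege1.
apply: (@le_trans _ _ (c ^+ k)).
  apply: lerXn2r; rewrite ?nnegrE ?mulr_ge0 ?exprn_ge0 //.
  by rewrite ler_piMl // exprn_ile1 // ltW.
have -> : c ^+ k = (2 * c) ^+ k * (1 / 2) ^+ k.
  by rewrite -exprMn; congr (_ ^+ _); field.
rewrite ler_wpM2r ?exprn_ge0 ?(ltW h0) //.
by apply: ler_weXn2l => //; exact: ltnW.
Qed.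

Let norm_exprz (x : C) (A : R) (n : int) : 1 <= A -> annulus A x ->
  `|x ^ n| <= emb (A ^+ `|n|).
Proof.
move=> A1 [x0 xA xA']; have A0 : 0 <= A by apply: le_trans A1.
rewrite rmorphXn; case: n => k.
  by rewrite -exprnP normrX; apply: lerXn2r; rewrite ?nnegrE ?emb_ge0.
rewrite NegzE -exprnN -exprVn normrX.
by apply: lerXn2r; rewrite ?nnegrE ?emb_ge0.
Qed.

Let norm_pexprz (n : int) (k l : nat) : 0 <= n -> (k <= `|n| + l)%N ->
  `|p ^ n| <= emb (r ^+ k * r^-1 ^+ l).
Proof.
have [r0 r1] := andP r01; case: n => // n _ /= kl.
rewrite -exprnP norm_expp embE exprVn ler_pdivlMr ?exprn_gt0 // -exprD.
by apply: ler_wiXn2l => //; exact: ltW.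
Qed.

(** A Gaussian sum still converges after multiplication by a geometric factor of
    ratio larger than one. *)
Let gauss_le (x : C) : x != 0 -> exists2 B : R, 0 <= B & forall u : int,
  `|gauss0 u x| * emb (r^-1 ^+ `|u|) <= emb (B * (1 / 2) ^+ `|u|) /\
  `|gauss1 u x| * emb (r^-1 ^+ `|u|) <= emb (B * (1 / 2) ^+ `|u|).
Proof.
move=> x0; have [r0 r1] := andP r01.
pose A := nrm x + nrm x^-1 + 1.
have [_ ax ax'] := in_annulus x0.
have nrm0 (z : C) : 0 <= nrm z by rewrite -emb_ge0 -normE.
have A1 : 1 <= A by rewrite lerDr addr_ge0.
have A0 : 0 <= A by apply: le_trans A1.
have Ax : annulus A x.
  split=> //; [apply: le_trans ax _|apply: le_trans ax' _];
  by rewrite embE lerDl.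
have rV1 : 1 <= r^-1 by rewrite invf_ge1 // ltW.
have rV0 : 0 <= r^-1 by rewrite invr_ge0.
pose c := r^-1 * r^-1 * (A * A).
have c1 : 1 <= c.
  by rewrite /c -[1](mulr1 1) ler_pM // ?mulr_ge0 // -[1](mulr1 1) ler_pM.
have [B0 B00 HB] := gauss_decay c1.
exists (A * B0) => [|u]; first by rewrite mulr_ge0.
set k := `|u|%N.
have fin (y : C) (e n : int) : 0 <= e -> (k * k <= `|e| + k)%N ->
    (`|n| <= (k + k).+1)%N -> y = p ^ e * x ^ n ->
    `|y| * emb (r^-1 ^+ k) <= emb (A * B0 * (1 / 2) ^+ k).
  move=> e0 ek nk ->; rewrite normrM.
  apply: (@le_trans _ _ (emb ((r ^+ (k * k) * r^-1 ^+ k * A ^+ (k + k).+1) *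
     r^-1 ^+ k))).
    rewrite (rmorphM emb) ler_wpM2r ?emb_ge0 ?exprn_ge0 // rmorphM.
    apply: ler_pM; rewrite ?normr_ge0 //; first exact: norm_pexprz.
    apply: le_trans (norm_exprz _ A1 Ax) _; rewrite embE.
    exact: ler_weXn2l.
  rewrite embE -[A * B0 * _]mulrA; apply: (@le_trans _ _ (A * (r ^+ k * c) ^+ k)).
    rewrite /c !exprMn exprM exprS exprD.
    by rewrite le_eqVlt; apply/orP; left; apply/eqP; ring.
  by rewrite ler_wpM2l.
have [e1 e2] := absz_triangular u; have [e3 e4] := absz_double u.
split; [apply: (@fin _ (u * u) (u * 2))|apply: (@fin _ (u * u + u) (u * 2 + 1))];
  rewrite // /k.
- exact: sqr_ge0.
- by rewrite abszM leq_addr.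
- by rewrite -e1.
Qed.

(** * The addition formula *)

(** The ranges are symmetric for the reflections [k -> - k] of [gauss0] and
    [k -> - 1 - k] of [gauss1].  With the same two functions on the even and the
    odd part, the main term is exactly alternating. *)
Definition gsum0 (m : nat) (x : C) : C :=
  \sum_(k < (m + m).+1) gauss0 (k%:Z - m%:Z) x.
Definition gsum1 (m : nat) (x : C) : C :=
  \sum_(k < (m + m).+2) gauss1 (k%:Z - m.+1%:Z) x.

(** The substitution rotates the square, and the ranges of [u] and [v] on the right
    are large enough to cover it; the points outside the square do not contribute.
    The first sum collects the pairs with [i + j] even, the second one those with
    [i + j] odd. *)
Lemma sum_square_diamond (F : int -> int -> C) m :
  (forall i j, (m < `|i|)%N || (m < `|j|)%N -> F i j = 0) ->
  \sum_(i < (m + m).+1) \sum_(j < (m + m).+1) F (i%:Z - m%:Z) (j%:Z - m%:Z) =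
  \sum_(u < (m + m).+2) \sum_(v < (m + m).+1)
     F ((u%:Z - m.+1%:Z) + 1 + (v%:Z - m%:Z)) ((u%:Z - m.+1%:Z) + 1 - (v%:Z - m%:Z))
  + \sum_(u < (m + m).+1) \sum_(v < (m + m).+2)
     F ((u%:Z - m%:Z) + (v%:Z - m.+1%:Z) + 1) ((u%:Z - m%:Z) - (v%:Z - m.+1%:Z)).
Proof.
move=> F0; set M2 := (m + m)%N.
have delta i' j' : F i' j' = \sum_(i < M2.+1) \sum_(j < M2.+1)
   ((i%:Z - m%:Z == i') && (j%:Z - m%:Z == j'))%:R * F (i%:Z - m%:Z) (j%:Z - m%:Z).
  have [h|] := boolP ((m < `|i'|)%N || (m < `|j'|)%N).
    rewrite F0 // big1 // => i _; rewrite big1 // => j _.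
    case: andP => [[/eqP hi /eqP hj]|]; rewrite ?mul0r // mul1r F0 //.
    by rewrite hi hj.
  rewrite negb_or -!leqNgt => /andP[hi hj].
  have li : (`|(i' + m%:Z)%R| < M2.+1)%N by rewrite /M2; lia.
  have lj : (`|(j' + m%:Z)%R| < M2.+1)%N by rewrite /M2; lia.
  have ei : (`|(i' + m%:Z)%R|%N)%:Z - m%:Z = i' by lia.
  have ej : (`|(j' + m%:Z)%R|%N)%:Z - m%:Z = j' by lia.
  rewrite (bigD1 (Ordinal li)) //= (bigD1 (Ordinal lj)) //= ei ej !eqxx mul1r.
  rewrite big1 ?addr0 => [|j jn].
    rewrite big1 ?addr0 // => i /negP hin; rewrite big1 // => j _.
    case: andP => [[/eqP e _]|]; rewrite ?mul0r //.
    by case: hin; apply/eqP/val_inj => /=; lia.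
  case: andP => [[_ /eqP e]|]; rewrite ?mul0r //.
  by case/negP: jn; apply/eqP/val_inj => /=; lia.
pose A (u v i j : nat) := ((i%:Z - m%:Z == (u%:Z - m.+1%:Z) + 1 + (v%:Z - m%:Z)) &&
  (j%:Z - m%:Z == (u%:Z - m.+1%:Z) + 1 - (v%:Z - m%:Z))).
pose B (u v i j : nat) := ((i%:Z - m%:Z == (u%:Z - m%:Z) + (v%:Z - m.+1%:Z) + 1) &&
  (j%:Z - m%:Z == (u%:Z - m%:Z) - (v%:Z - m.+1%:Z))).
have count (i j : 'I_M2.+1) :
    \sum_(u < M2.+2) \sum_(v < M2.+1) (A u v i j)%:R +
    \sum_(u < M2.+1) \sum_(v < M2.+2) (B u v i j)%:R = 1 :> C.
  have [hi hj] := (ltn_ord i, ltn_ord j); rewrite /M2 in hi hj.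
  have [od|ev] := boolP (odd (i + j)).
    have lu : ((i + j)./2 < M2.+1)%N by rewrite /M2; lia.
    have lv : ((i + M2.+1 - j)./2 < M2.+2)%N by rewrite /M2; lia.
    rewrite big1 ?add0r => [|u _]; last first.
      rewrite big1 // => v _; suff -> : A u v i j = false by [].
      by apply/negP; rewrite /A => /andP[/eqP h1 /eqP h2]; lia.
    rewrite (bigD1 (Ordinal lu)) //= (bigD1 (Ordinal lv)) //=.
    have -> : B (i + j)./2 (i + M2.+1 - j)./2 i j.
      by rewrite /B /M2; apply/andP; split; apply/eqP; lia.
    rewrite !big1 ?addr0 // => [u|v] hn; last first.
      case: (boolP (B _ _ _ _)) => // /andP[/eqP h1 /eqP h2].
      case/negP: hn; apply/eqP/val_inj => /=.
      have es : (i + j = ((i + j)./2).*2.+1)%N.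
        by rewrite -[LHS]odd_double_half od.
      have -> : (i + M2.+1 - j = (i + m - (i + j)./2).*2)%N by rewrite /M2; lia.
      by rewrite doubleK; lia.
    rewrite big1 // => v _; case: (boolP (B _ _ _ _)) => // /andP[/eqP h1 /eqP h2].
    by case/negP: hn; apply/eqP/val_inj => /=; lia.
  have lu : ((i + j)./2 < M2.+2)%N by rewrite /M2; lia.
  have lv : ((i + M2 - j)./2 < M2.+1)%N by rewrite /M2; lia.
  rewrite addrC big1 ?add0r => [|u _]; last first.
    rewrite big1 // => v _; suff -> : B u v i j = false by [].
    by apply/negP; rewrite /B => /andP[/eqP h1 /eqP h2]; lia.
  rewrite (bigD1 (Ordinal lu)) //= (bigD1 (Ordinal lv)) //=.
  have -> : A (i + j)./2 (i + M2 - j)./2 i j.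
    by rewrite /A /M2; apply/andP; split; apply/eqP; lia.
  rewrite !big1 ?addr0 // => [u|v] hn; last first.
    case: (boolP (A _ _ _ _)) => // /andP[/eqP h1 /eqP h2].
    case/negP: hn; apply/eqP/val_inj => /=.
    have es : (i + j = ((i + j)./2).*2)%N.
      by rewrite -[LHS]odd_double_half (negbTE ev).
    have -> : (i + M2 - j = (i + m - (i + j)./2).*2)%N by rewrite /M2; lia.
    by rewrite doubleK; lia.
  rewrite big1 // => v _; case: (boolP (A _ _ _ _)) => // /andP[/eqP h1 /eqP h2].
  by case/negP: hn; apply/eqP/val_inj => /=; lia.
have gather (I1 I2 : nat) (g h : nat -> nat -> int) :
   \sum_(u < I1) \sum_(v < I2) F (g u v) (h u v) =
   \sum_(i < M2.+1) \sum_(j < M2.+1) (\sum_(u < I1) \sum_(v < I2)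
     ((i%:Z - m%:Z == g u v) && (j%:Z - m%:Z == h u v))%:R) *
     F (i%:Z - m%:Z) (j%:Z - m%:Z).
  under eq_bigr => u _ do under eq_bigr => v _ do rewrite delta.
  rewrite exchange_big /=; under eq_bigr => v _ do rewrite exchange_big /=.
  rewrite exchange_big /=; apply: eq_bigr => i _.
  under eq_bigr => v _ do rewrite exchange_big /=.
  rewrite exchange_big /=; apply: eq_bigr => j _.
  rewrite exchange_big mulr_suml; apply: eq_bigr => u _.
  by rewrite mulr_suml.
rewrite (gather _ _ (fun u v => (u%:Z - m.+1%:Z) + 1 + (v%:Z - m%:Z))
  (fun u v => (u%:Z - m.+1%:Z) + 1 - (v%:Z - m%:Z))).
rewrite (gather _ _ (fun u v => (u%:Z - m%:Z) + (v%:Z - m.+1%:Z) + 1)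
  (fun u v => (u%:Z - m%:Z) - (v%:Z - m.+1%:Z))).
rewrite -big_split; apply: eq_bigr => i _; rewrite -big_split.
by apply: eq_bigr => j _ /=; rewrite -mulrDl count mul1r.
Qed.

(* The normalized product of theta truncations, and its rank two main term. *)
Let E (m : nat) (x y : C) : C := euler 0 (m + m) * euler 0 (m + m) *
  (theta_prod (x * y) m * theta_prod (x / y) m) / x.

Let D (m : nat) (x y : C) : C := gsum1 m x * gsum0 m y - gsum0 m x * gsum1 m y.

Let E_sum m x y : x != 0 -> y != 0 -> E m x y =
  \sum_(u < (m + m).+2) \sum_(v < (m + m).+1)
    (qcoef m ((u%:Z - m.+1%:Z) + 1 + (v%:Z - m%:Z)) *
     qcoef m ((u%:Z - m.+1%:Z) + 1 - (v%:Z - m%:Z))) *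
    (gauss1 (u%:Z - m.+1%:Z) x * gauss0 (v%:Z - m%:Z) y) -
  \sum_(u < (m + m).+1) \sum_(v < (m + m).+2)
    (qcoef m ((u%:Z - m%:Z) + (v%:Z - m.+1%:Z) + 1) *
     qcoef m ((u%:Z - m%:Z) - (v%:Z - m.+1%:Z))) *
    (gauss0 (u%:Z - m%:Z) x * gauss1 (v%:Z - m.+1%:Z) y).
Proof.
move=> x0 y0; have xy0 : x * y != 0 by rewrite mulf_neq0.
have xy0' : x / y != 0 by rewrite mulf_neq0 ?invr_neq0.
pose F i j := qcoef m i * jterm (x * y) i * (qcoef m j * jterm (x / y) j).
have F0 i j : (m < `|i|)%N || (m < `|j|)%N -> F i j = 0.
  by case/orP => h; rewrite /F (qcoef_out h) !mul0r // mulr0.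
have tp a : a != 0 -> euler 0 (m + m) * theta_prod a m =
    \sum_(k < (m + m).+1) qcoef m (k%:Z - m%:Z) * jterm a (k%:Z - m%:Z).
  move=> a0; rewrite triple_product // mulr_sumr; apply: eq_bigr => k _.
  by rewrite /qcoef subrK /=; ring.
rewrite /E; apply: (mulIf x0); rewrite divfK //.
transitivity (euler 0 (m + m) * theta_prod (x * y) m *
  (euler 0 (m + m) * theta_prod (x / y) m)); first by ring.
rewrite !tp // mulr_suml.
transitivity (\sum_(i < (m + m).+1) \sum_(j < (m + m).+1)
   F (i%:Z - m%:Z) (j%:Z - m%:Z)).
  by apply: eq_bigr => i _; rewrite mulr_sumr.
rewrite (sum_square_diamond F0) mulrBl !mulr_suml -sumrN.
congr (_ + _); apply: eq_bigr => u _; rewrite mulr_suml -?sumrN; apply: eq_bigr => v _;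
  rewrite /F mulrACA ?jterm_mul_even ?jterm_mul_odd //; ring.
Qed.

Let E_D x y : x != 0 -> y != 0 ->
  exists K : R, forall m, `|E m x y - D m x y| <= emb (K * r ^+ m).
Proof.
move=> x0 y0; have [r0 r1] := andP r01.
have [H H0 HH] := qcoef_near1.
have [Bx Bx0 HBx] := gauss_le x0; have [By By0 HBy] := gauss_le y0.
have rV0 : 0 <= r^-1 by rewrite invr_ge0.
have h0 : 0 <= (1 / 2 : R) by rewrite divr_ge0.
pose G := H * r^-1 * (Bx * By).
have G0 : 0 <= G by apply: mulr_ge0; apply: mulr_ge0.
have one m (i j u v : int) (g1 g2 : C) : (`|i| <= (`|u| + `|v|).+1)%N ->
    (`|j| <= (`|u| + `|v|).+1)%N ->
    `|g1| * emb (r^-1 ^+ `|u|) <= emb (Bx * (1 / 2) ^+ `|u|) ->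
    `|g2| * emb (r^-1 ^+ `|v|) <= emb (By * (1 / 2) ^+ `|v|) ->
    `|(qcoef m i * qcoef m j - 1) * (g1 * g2)| <=
    emb (G * r ^+ m * ((1 / 2) ^+ `|u| * (1 / 2) ^+ `|v|)).
  move=> hi hj hg1 hg2; have := HH m i j _ hi hj; set s := (_ + _).+1 => hq.
  have rs : emb (r ^+ s * (r^-1 * (r^-1 ^+ `|u| * r^-1 ^+ `|v|))) = 1.
    rewrite -(rmorph1 emb); congr (emb _).
    rewrite -exprD -exprS exprVn divff // expf_neq0 //; exact: lt0r_neq0.
  rewrite -[X in X <= _]mulr1 -[X in _ * X <= _]rs !normrM.
  set q := `|qcoef m i * qcoef m j - 1|.
  have -> : q * (`|g1| * `|g2|) *
      emb (r ^+ s * (r^-1 * (r^-1 ^+ `|u| * r^-1 ^+ `|v|))) =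
    (q * emb (r ^+ s)) * emb r^-1 *
    ((`|g1| * emb (r^-1 ^+ `|u|)) * (`|g2| * emb (r^-1 ^+ `|v|))).
    by rewrite !(rmorphM emb); ring.
  have -> : emb (G * r ^+ m * ((1 / 2) ^+ `|u| * (1 / 2) ^+ `|v|)) =
     emb (H * r ^+ m) * emb r^-1 *
     (emb (Bx * (1 / 2) ^+ `|u|) * emb (By * (1 / 2) ^+ `|v|)).
    by rewrite /G !(rmorphM emb); ring.
  have e0 k : 0 <= emb (r ^+ k) by rewrite emb_ge0 exprn_ge0.
  have e1 k : 0 <= emb (r^-1 ^+ k) by rewrite emb_ge0 exprn_ge0.
  have e2 : 0 <= emb r^-1 by rewrite emb_ge0.
  apply: ler_pM => //; do ?[apply: mulr_ge0 => //]; rewrite ?normr_ge0 //.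
    by rewrite ler_wpM2r.
  by apply: ler_pM => //; apply: mulr_ge0.
have sum2 m (I1 I2 c1 c2 : nat) (i j : nat -> nat -> int) (g1 g2 : int -> C) :
    (forall u v, (`|i u v| <= (`|(u%:Z - c1%:Z)%R| + `|(v%:Z - c2%:Z)%R|).+1)%N) ->
    (forall u v, (`|j u v| <= (`|(u%:Z - c1%:Z)%R| + `|(v%:Z - c2%:Z)%R|).+1)%N) ->
    (forall u, `|g1 u| * emb (r^-1 ^+ `|u|) <= emb (Bx * (1 / 2) ^+ `|u|)) ->
    (forall u, `|g2 u| * emb (r^-1 ^+ `|u|) <= emb (By * (1 / 2) ^+ `|u|)) ->
    `|\sum_(u < I1) \sum_(v < I2) (qcoef m (i u v) * qcoef m (j u v)) *
        (g1 (u%:Z - c1%:Z) * g2 (v%:Z - c2%:Z)) -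
      (\sum_(u < I1) g1 (u%:Z - c1%:Z)) * (\sum_(v < I2) g2 (v%:Z - c2%:Z))| <=
    emb (9 * G * r ^+ m).
  move=> hi hj hg1 hg2.
  have -> : (\sum_(u < I1) g1 (u%:Z - c1%:Z)) * (\sum_(v < I2) g2 (v%:Z - c2%:Z)) =
     \sum_(u < I1) \sum_(v < I2) (g1 (u%:Z - c1%:Z) * g2 (v%:Z - c2%:Z)).
    by rewrite mulr_suml; apply: eq_bigr => u _; rewrite mulr_sumr.
  rewrite -sumrB; under eq_bigr => u _ do rewrite -sumrB.
  apply: le_trans (ler_norm_sum _ _ _) _.
  apply: (@le_trans _ _ (\sum_(u < I1) \sum_(v < I2) emb (G * r ^+ m *
     ((1 / 2) ^+ `|u%:Z - c1%:Z| * (1 / 2) ^+ `|v%:Z - c2%:Z|)))).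
    apply: ler_sum => u _; apply: le_trans (ler_norm_sum _ _ _) _.
    apply: ler_sum => v _; rewrite -[X in _ - X]mul1r -mulrBl.
    exact: one.
  under eq_bigr => u _ do rewrite -(rmorph_sum emb).
  rewrite -(rmorph_sum emb) embE.
  have -> : \sum_(u < I1) \sum_(v < I2) (G * r ^+ m *
     ((1 / 2) ^+ `|u%:Z - c1%:Z| * (1 / 2) ^+ `|v%:Z - c2%:Z|)) = G * r ^+ m *
     ((\sum_(u < I1) (1 / 2) ^+ `|u%:Z - c1%:Z|) *
      (\sum_(v < I2) (1 / 2) ^+ `|v%:Z - c2%:Z|)).
    rewrite mulr_suml mulr_sumr; apply: eq_bigr => u _.
    by rewrite !mulr_sumr.
  have -> : 9 * G * r ^+ m = G * r ^+ m * (3 * 3) by ring.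
  apply: ler_wpM2l; first by rewrite mulr_ge0 ?exprn_ge0.
  apply: ler_pM; rewrite ?half_sum //; apply: sumr_ge0 => k _; exact: exprn_ge0.
exists (18 * G) => m; rewrite (E_sum _ x0 y0) /D.
set S1 := \sum_(u < (m + m).+2) _; set S2 := \sum_(u < (m + m).+1) _.
have -> : S1 - S2 - (gsum1 m x * gsum0 m y - gsum0 m x * gsum1 m y) =
  (S1 - gsum1 m x * gsum0 m y) - (S2 - gsum0 m x * gsum1 m y) by ring.
have -> : 18 * G * r ^+ m = 9 * G * r ^+ m + 9 * G * r ^+ m by ring.
rewrite rmorphD; apply: le_trans (ler_normB _ _) _; apply: lerD.
  apply: (sum2 m (m + m).+2 (m + m).+1 m.+1 m
    (fun u v => (u%:Z - m.+1%:Z) + 1 + (v%:Z - m%:Z))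
    (fun u v => (u%:Z - m.+1%:Z) + 1 - (v%:Z - m%:Z))
    (fun u => gauss1 u x) (fun v => gauss0 v y)).
  - by move=> u v; case: (absz_add_bounds (u%:Z - m.+1%:Z) (v%:Z - m%:Z)).
  - by move=> u v; case: (absz_add_bounds (u%:Z - m.+1%:Z) (v%:Z - m%:Z)).
  - by move=> u; case: (HBx u).
  - by move=> u; case: (HBy u).
apply: (sum2 m (m + m).+1 (m + m).+2 m m.+1
    (fun u v => (u%:Z - m%:Z) + (v%:Z - m.+1%:Z) + 1)
    (fun u v => (u%:Z - m%:Z) - (v%:Z - m.+1%:Z))
    (fun u => gauss0 u x) (fun v => gauss1 v y)).
- by move=> u v; case: (absz_add_bounds (u%:Z - m%:Z) (v%:Z - m.+1%:Z)).
- by move=> u v; case: (absz_add_bounds (u%:Z - m%:Z) (v%:Z - m.+1%:Z)).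
- by move=> u; case: (HBx u).
- by move=> u; case: (HBy u).
Qed.

(** A 2 by 2 determinant satisfies the three-term Pluecker relation; so does a
    limit of such determinants. *)
Lemma theta_addition_nonzero (x y u w : C) :
  let F s t := theta p (s * t) * theta p (s / t) / s in
  x != 0 -> y != 0 -> u != 0 -> w != 0 ->
  F x y * F u w - F x u * F y w + F x w * F y u = 0.
Proof.
move=> F x0 y0 u0 w0.
have [phi phi0 hphi] := euler_cvg.
have hphi2 : ((fun m => euler 0 (m + m)) @ \oo --> phi)%classic.
  apply: (cvg_comp _ _ _ hphi); apply/cvgnyPge => A.
  by exists A => // n /= An; apply: leq_trans An (leq_addr _ _).
have ED s t : s != 0 -> t != 0 ->
    ((fun m => D m s t) @ \oo --> phi * phi * F s t)%classic.
  move=> s0 t0; have st0 : s * t != 0 by rewrite mulf_neq0.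
  have st0' : s / t != 0 by rewrite mulf_neq0 ?invr_neq0.
  have hE : ((fun m => E m s t) @ \oo --> phi * phi * F s t)%classic.
    rewrite /F mulrA; apply: cvgMl; apply: cvgM.
      by apply: cvgM.
    by apply: cvgM; apply: theta_prod_cvg.
  have [K HK] := E_D s0 t0.
  have hd : ((fun m => E m s t - D m s t) @ \oo --> (0 : C))%classic.
    apply/cvgrPdist_lt => e e0; have [e' e'0 ->] := embP e0.
    have [J HJ] := geometric_small K r01 e'0.
    exists J => // k /= Jk; rewrite sub0r normrN.
    by apply: le_lt_trans (HK k) _; rewrite embltE HJ.
  have := cvgB hE hd; rewrite subr0.
  have -> : (fun m => E m s t) - (fun m => E m s t - D m s t) = (fun m => D m s t).
    by apply/funext => m; rewrite !fctE subKr.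
  by apply.
have lim0 : ((fun m => D m x y * D m u w - D m x u * D m y w + D m x w * D m y u)
   @ \oo --> (phi * phi * F x y) * (phi * phi * F u w) -
   (phi * phi * F x u) * (phi * phi * F y w) +
   (phi * phi * F x w) * (phi * phi * F y u))%classic.
  by apply: cvgD; [apply: cvgB|]; apply: cvgM; apply: ED.
have D0 : (fun m => D m x y * D m u w - D m x u * D m y w + D m x w * D m y u) =
    (fun=> 0).
  by apply/funext => m; rewrite /D; ring.
rewrite D0 in lim0.
have := cvg_unique _ lim0 (cvg_cst 0) => /(_ (@norm_hausdorff _ _)) e.
have phi4 : phi * phi * (phi * phi) != 0 by rewrite !mulf_neq0.
apply: (mulfI phi4); rewrite mulr0 -[RHS]e; ring.
Qed.

End AdditionFormula.

(** In the degenerate case [p = 0] theta is [1 - a]. *)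
Lemma theta_addition (x y u w : C) :
  let F s t := theta p (s * t) * theta p (s / t) / s in
  x != 0 -> y != 0 -> u != 0 -> w != 0 ->
  F x y * F u w - F x u * F y w + F x w * F y u = 0.
Proof.
have [p0|pn0] := eqVneq p 0; last exact: theta_addition_nonzero.
move=> F x0 y0 u0 w0.
have th a : a != 0 -> theta p a = 1 - a.
  move=> a0; have hcv := theta_prod_cvg a0.
  have e (m : nat) : theta_prod a m.+1 = 1 - a.
    rewrite /theta_prod big_ord_recl big1 => [|j _]; rewrite p0.
      by rewrite expr0 expr1 mul0r !mulr1 subr0 mulr1.
    by rewrite !exprS !mul0r mulr0 !subr0 mulr1.
  have : ((fun m => theta_prod a m.+1) @ \oo --> theta p a)%classic.
    by rewrite (cvg_shiftS (theta_prod a)).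
  rewrite (_ : (fun m => theta_prod a m.+1) = (fun=> 1 - a)); last exact/funext.
  by move=> h; apply: (cvg_unique _ h (cvg_cst _)).
rewrite /F !th ?mulf_neq0 ?invr_neq0 //; field.
by rewrite x0 y0 u0 w0.
Qed.

End ThetaAnalysis.

(** * The theta function on the complex numbers *)

Section ComplexTheta.
Variable R : realType.
Local Notation C := (R[i] : numFieldType).
Local Notation normc := ComplexField.Normc.normc.

Let embE : {mono (real_complex R) : x y / x <= y}.
Proof. exact: lecR. Qed.

Let normE (z : C) : `|z| = real_complex R (normc z).
Proof. by []. Qed.

(** Completeness of the complex field, for sequences with a geometric rate. *)
Lemma complex_geometric_cvg (c r : R) (z : nat -> C) : 0 <= r < 1 ->
  (forall m k, (m <= k)%N -> `|z k - z m| <= real_complex R (c * r ^+ m)) ->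
  exists l : C, (z @ \oo --> l)%classic.
Proof.
move=> r01 hz.
have part (f : R[i] -> R) : (forall u v, f (u - v) = f u - f v) ->
    (forall u, `|f u| <= normc u) ->
    exists l : R, ((fun m => f (z m)) @ \oo --> l)%classic.
  move=> fB fle; apply/cvg_ex/cauchy_cvgP/cauchy_exP => e e0.
  have [J HJ] := geometric_small c r01 e0.
  exists (f (z J)); exists J => // m /= Jm.
  rewrite /ball /= distrC -fB; apply: le_lt_trans (fle _) _.
  by apply: le_lt_trans (HJ J (leqnn J)); rewrite -lecR; exact: hz.
have normcRe (u : R[i]) : `|complex.Re u| <= normc u.
  case: u => a b /=; rewrite -sqrtr_sqr ler_wsqrtr // lerDl; exact: sqr_ge0.
have normcIm (u : R[i]) : `|complex.Im u| <= normc u.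
  case: u => a b /=; rewrite -sqrtr_sqr ler_wsqrtr // lerDr; exact: sqr_ge0.
have [|l1 h1] := part (@complex.Re R) _ normcRe; first by case=> a b; case.
have [|l2 h2] := part (@complex.Im R) _ normcIm; first by case=> a b; case.
exists (Complex l1 l2); apply/cvgrPdist_lt => e e0.
have [e' e'0 ee'] : exists2 e' : R, 0 < e' & e = real_complex R (e' + e').
  case: e e0 => a b; rewrite ltcE /= => /andP[/eqP-> a0].
  by exists (a / 2); [rewrite divr_gt0|rewrite -splitr].
move/cvgrPdist_lt : h1 => /(_ e' e'0) h1; move/cvgrPdist_lt : h2 => /(_ e' e'0) h2.
near=> m.
have H1 : `|l1 - complex.Re (z m)| < e' by near: m.
have H2 : `|l2 - complex.Im (z m)| < e' by near: m.
rewrite ee' normE ltcR.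
have triangle (a b : R) : normc (Complex a b) <= `|a| + `|b|.
  rewrite /= -[leRHS]ger0_norm ?addr_ge0 // -sqrtr_sqr ler_wsqrtr // sqrrD.
  rewrite !real_normK ?num_real // lerD2r lerDl mulrn_wge0 // mulr_ge0 //.
apply: le_lt_trans _ (ltrD H1 H2).
by case: (z m) => a b; exact: triangle.
Unshelve. all: by end_near.
Qed.

Variable p : C.
Hypothesis hp : `|p| < 1.

Lemma complex_thetaV (a : C) : a != 0 -> theta p a^-1 = - a^-1 * theta p a.
Proof. exact: (thetaV embE normE complex_geometric_cvg hp). Qed.

Lemma complex_theta_addition (x y u w : C) :
  let F s t := theta p (s * t) * theta p (s / t) / s in
  x != 0 -> y != 0 -> u != 0 -> w != 0 ->
  F x y * F u w - F x u * F y w + F x w * F y u = 0.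
Proof. exact: (theta_addition embE normE complex_geometric_cvg hp). Qed.

Lemma complex_theta_continuous (c : C) : c != 0 ->
  (theta p t @[t --> c] --> theta p c)%classic.
Proof. exact: (theta_continuous embE normE complex_geometric_cvg hp). Qed.

Lemma complex_theta_near_neq0 (c : C) : c != 0 ->
  (\forall t \near c^', theta p t != 0)%classic.
Proof. exact: (theta_near_neq0 embE normE complex_geometric_cvg hp). Qed.

End ComplexTheta.

(** * Multi-indices *)

Lemma nat_sub_split a b w : (a + b <= w)%N -> (b + (w - (a + b)) = w - a)%N.
Proof. lia. Qed.

Lemma nat_sub_shift a b c w : (a + b <= w)%N ->
  (a + (c + b) + (w - (a + b)) = c + w)%N.
Proof. lia. Qed.

Section MultiIndices.
Variable n : nat.
Implicit Types (j k N : multi n).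

Definition lev j k : bool := [forall r, (j r <= k r)%N].

Lemma levP j k : reflect (forall r, (j r <= k r)%N) (lev j k).
Proof. exact: forallP. Qed.

Lemma lev_refl j : lev j j. Proof. by apply/levP. Qed.

Lemma lev_trans j k N : lev j k -> lev k N -> lev j N.
Proof. by move=> /levP h /levP h'; apply/levP => r; exact: leq_trans (h r) (h' r). Qed.

Lemma wt_lev j k : lev j k -> (wt j <= wt k)%N.
Proof. by move=> /levP h; apply: leq_sum => r _; exact: h. Qed.

Lemma wt_sub j k : lev j k -> (\sum_(r < n) (k r - j r) = wt k - wt j)%N.
Proof. by move=> /levP h; rewrite sumnB. Qed.

Lemma lev_wt_eq j k : lev j k -> wt j = wt k -> j = k.
Proof.
move=> h e; have := wt_sub h; rewrite e subnn => /eqP; rewrite sum_nat_eq0 => /forallP s0.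
apply/ffunP => r; apply/eqP; rewrite eqn_leq (levP _ _ h) /=.
by have := s0 r; rewrite subn_eq0.
Qed.

Lemma leq_wt j r : (j r <= wt j)%N.
Proof. by rewrite /wt (bigD1 r) //= leq_addr. Qed.

(** The multi-indices below [N] as a sequence: a common type for all bounds, which
    the exchange of nested sums needs. *)
Definition below N : seq (multi n) :=
  [seq [ffun r => t r : nat] | t : {dffun forall r : 'I_n, 'I_(N r).+1}].

Lemma mem_below N k : (k \in below N) = lev k N.
Proof.
apply/mapP/levP => [[t _ ->] r|h]; first by rewrite ffunE -ltnS.
exists [ffun r => inord (k r)]; first by rewrite mem_enum.
by apply/ffunP => r; rewrite !ffunE inordK // ltnS.
Qed.

Lemma below_uniq N : uniq (below N).
Proof.
rewrite map_inj_uniq ?enum_uniq // => s t /ffunP e.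
by apply/ffunP => r; apply: val_inj; have := e r; rewrite !ffunE.
Qed.

Lemma sum_belowE (K : numFieldType) N (F : multi n -> K) :
  sum_below N F = \sum_(k <- below N) F k.
Proof. by rewrite big_image. Qed.

Lemma exchange_below (K : nmodType) N (g : multi n -> multi n -> K) :
  \sum_(k <- below N) \sum_(j <- below k) g k j =
  \sum_(j <- below N) \sum_(k <- below N | lev j k) g k j.
Proof.
rewrite (exchange_big_dep xpredT) //= big_seq [RHS]big_seq.
apply: eq_bigr => k kN.
rewrite -[RHS]big_filter; apply: perm_big; apply: uniq_perm.
- exact: below_uniq.
- exact/filter_uniq/below_uniq.
move=> j; rewrite mem_filter !mem_below; apply/idP/andP => [h|[]//].
by split=> //; apply: lev_trans h _; rewrite -mem_below.
Qed.

(** The successor makes [upd j i m] the lower bound that remains when the terms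
    with [k i <= m] are discarded. *)
Definition upd j (i : 'I_n) (m : nat) : multi n :=
  [ffun r => if r == i then m.+1 else j r].

Lemma wt_upd j i m : (j i <= m)%N -> wt (upd j i m) = (wt j + (m.+1 - j i))%N.
Proof.
move=> h; rewrite /wt (bigD1 i) //= [in RHS](bigD1 i) //= ffunE eqxx.
rewrite (eq_bigr (fun r => j r)) => [|r ri]; last by rewrite ffunE (negbTE ri).
by move: (\sum_(_ < _ | _) _)%N => S; lia.
Qed.

Lemma lev_upd j k i m : (j i <= m)%N ->
  lev (upd j i m) k = lev j k && (m < k i)%N.
Proof.
move=> h; apply/levP/andP => [H|[/levP H mk] r].
  have hi := H i; rewrite ffunE eqxx in hi; split=> //; apply/levP => r.
  have := H r; rewrite ffunE; case: eqP => [->|//] h'.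
  by apply: leq_trans h (ltnW h').
by rewrite ffunE; case: eqP => [->|].
Qed.

(** Stated with factors on both sides so that it applies without divisions. *)
Lemma prod_upd (K : comPzRingType) (F : 'I_n -> nat -> K) j i m P Q :
  F i m.+1 * P = F i (j i) * Q ->
  (\prod_r F r (upd j i m r)) * P = (\prod_r F r (j r)) * Q.
Proof.
move=> h; rewrite (bigD1 i) //= [in RHS](bigD1 i) //= ffunE eqxx.
rewrite (eq_bigr (fun r => F r (j r))) => [|r ri]; last by rewrite ffunE (negbTE ri).
by rewrite mulrAC h mulrAC.
Qed.

End MultiIndices.

(** * Binary forms in theta functions *)

(** In this section theta enters only through inversion, its zero at 1 and the
    addition formula.  Square roots serve to move the center [g] of the brackets to 1. *)
Section ThetaForms.
Variables (K : fieldType) (th : K -> K).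
Hypothesis thV : forall a, a != 0 -> th a^-1 = - a^-1 * th a.
Hypothesis th1 : th 1 = 0.
Hypothesis th_addition : forall x y u w,
  let F s t := th (s * t) * th (s / t) / s in
  x != 0 -> y != 0 -> u != 0 -> w != 0 ->
  F x y * F u w - F x u * F y w + F x w * F y u = 0.
Hypothesis has_sqrt : forall g : K, exists s, s ^+ 2 = g.

Section FixedCenter.
Variable g : K.
Hypothesis g0 : g != 0.

(** Antisymmetric in [a] and [c]; as a function of [a] it vanishes at [c] and at the
    mirror point [g / c]. *)
Definition bracket (a c : K) : K := th (a * c / g) * th (a / c) / a.

(** The addition formula at the points divided by a square root of [g]. *)
Lemma bracket_plucker a b c d : a != 0 -> b != 0 -> c != 0 -> d != 0 ->
  bracket a b * bracket c d - bracket a c * bracket b d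
    + bracket a d * bracket b c = 0.
Proof.
move=> a0 b0 c0 d0; have [s sg] := has_sqrt g.
have s0 : s != 0 by apply: contra_neq g0 => s0; rewrite -sg s0 expr0n.
pose F x y := th (x * y) * th (x / y) / x.
have E x y : x != 0 -> y != 0 -> bracket x y = F (x / s) (y / s) / s.
  move=> x0 y0; rewrite /bracket /F.
  have -> : x / s * (y / s) = x * y / g by rewrite -sg; field.
  have -> : x / s / (y / s) = x / y by field; rewrite y0.
  by field; rewrite x0 s0.
have := th_addition (x := a / s) (y := b / s) (u := c / s) (w := d / s).
rewrite !mulf_neq0 ?invr_neq0 // => /(_ isT isT isT isT) H.
rewrite !E // -[RHS](mul0r (s ^- 2)) -H /F; field.
by rewrite a0 b0 c0 s0.
Qed.

Lemma bracket_sym a c : a != 0 -> c != 0 -> bracket c a = - bracket a c.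
Proof.
move=> a0 c0; rewrite /bracket -[c / a]invf_div thV ?mulf_neq0 ?invr_neq0 //.
by rewrite [c * a]mulrC; field; rewrite a0 c0.
Qed.

Lemma bracketaa a : a != 0 -> bracket a a = 0.
Proof. by move=> a0; rewrite /bracket divff // th1 mulr0 mul0r. Qed.

(** The binary forms of degree [d].  Quantifying over all pairs of independent base
    points makes the notion independent of coordinates: multiplication by a bracket
    and division by a linear factor are then immediate. *)
Fixpoint form (d : nat) (f : K -> K) : Prop :=
  match d with
  | 0 => exists c, forall a, a != 0 -> f a = c
  | d.+1 => forall u v, u != 0 -> v != 0 -> bracket u v != 0 ->
      exists f1 f2, [/\ form d f1, form d f2 &
        forall a, a != 0 -> f a = bracket a u * f1 a + bracket a v * f2 a]
  end.

Lemma form_ext d f f' : (forall a, a != 0 -> f a = f' a) -> form d f -> form d f'.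
Proof.
case: d => [|d] E /=.
  by case=> c H; exists c => a a0; rewrite -E // H.
move=> H u v u0 v0 uv; have [f1 [f2 [h1 h2 h]]] := H u v u0 v0 uv.
by exists f1, f2; split => // a a0; rewrite -E // h.
Qed.

Lemma form_zero d : form d (fun=> 0).
Proof.
elim: d => [|d IH] /=; first by exists 0.
by move=> u v _ _ _; exists (fun=> 0), (fun=> 0); split=> // a _; rewrite !mulr0 addr0.
Qed.

Lemma form_add d f f' : form d f -> form d f' -> form d (fun a => f a + f' a).
Proof.
elim: d f f' => [|d IH] f f' /=.
  by move=> [c H] [c' H']; exists (c + c') => a a0; rewrite H // H'.
move=> H H' u v u0 v0 uv.
have [f1 [f2 [h1 h2 h]]] := H u v u0 v0 uv.
have [f1' [f2' [h1' h2' h']]] := H' u v u0 v0 uv.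
exists (fun a => f1 a + f1' a), (fun a => f2 a + f2' a); split; try exact: IH.
by move=> a a0; rewrite h // h' //; ring.
Qed.

Lemma form_scale d c f : form d f -> form d (fun a => c * f a).
Proof.
elim: d f => [|d IH] f /=.
  by move=> [c' H]; exists (c * c') => a a0; rewrite H.
move=> H u v u0 v0 uv.
have [f1 [f2 [h1 h2 h]]] := H u v u0 v0 uv.
exists (fun a => c * f1 a), (fun a => c * f2 a); split; try exact: IH.
by move=> a a0; rewrite h //; ring.
Qed.

Lemma form_sum d (I : Type) (s : seq I) (P : pred I) (f : I -> K -> K) :
  (forall i, P i -> form d (f i)) -> form d (fun a => \sum_(i <- s | P i) f i a).
Proof.
move=> H; elim: s => [|i s IH].
  by apply: form_ext (form_zero d) => a _; rewrite big_nil.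
have [Pi|nPi] := boolP (P i).
  apply: form_ext (form_add (H i Pi) IH) => a _; by rewrite big_cons Pi.
by apply: form_ext IH => a _; rewrite big_cons (negbTE nPi).
Qed.

(** The Pluecker relation expresses [bracket a y] by [bracket a u] and
    [bracket a v]. *)
Lemma form_mul_bracket d f y : y != 0 -> form d f ->
  form d.+1 (fun a => bracket a y * f a).
Proof.
move=> y0 H u v u0 v0 uv.
exists (fun a => bracket y v / bracket u v * f a).
exists (fun a => - bracket y u / bracket u v * f a).
split; try exact: form_scale.
move=> a a0; apply: (mulfI uv); have := bracket_plucker a0 y0 u0 v0.
move=> E; have {}E : bracket a y * bracket u v =
    bracket a u * bracket y v - bracket a v * bracket y u.
  by apply/eqP; rewrite -subr_eq0 -[X in _ == X]E; apply/eqP; ring.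
transitivity (bracket a y * bracket u v * f a); first by ring.
by rewrite E; field.
Qed.

(** With [x0] as one of the base points, the coefficient of the pure power of the
    other coordinate is the value at [x0]. *)
Lemma form_factor d f x0 x1 : x0 != 0 -> x1 != 0 -> bracket x0 x1 != 0 ->
  form d.+1 f -> f x0 = 0 ->
  exists2 f', form d f' & forall a, a != 0 -> f a = bracket a x0 * f' a.
Proof.
move=> x00 x10 h; elim: d f => [|d IH] f H fx.
  have [f1 [f2 [h1 [c h2] hf]]] := H x0 x1 x00 x10 h.
  exists f1 => // a a0; rewrite hf // h2 //.
  move: fx; rewrite hf // bracketaa // mul0r add0r h2 // => /eqP.
  by rewrite mulf_eq0 (negbTE h) => /eqP ->; rewrite mulr0 addr0.
have [f1 [f2 [h1 h2 hf]]] := H x0 x1 x00 x10 h.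
have f2x : f2 x0 = 0.
  move: fx; rewrite hf // bracketaa // mul0r add0r => /eqP.
  by rewrite mulf_eq0 (negbTE h) => /eqP.
have [f3 h3 hf3] := IH _ h2 f2x.
exists (fun a => f1 a + bracket a x1 * f3 a).
  by apply: form_add => //; exact: form_mul_bracket.
by move=> a a0; rewrite hf // hf3 //; ring.
Qed.

(** A binary form of degree [d] with [d + 1] distinct zeros vanishes. *)
Lemma form_eq0 d f (pts : seq K) : form d f -> size pts = d.+1 ->
  all (fun x => x != 0) pts -> pairwise (fun x y => bracket x y != 0) pts ->
  all (fun x => f x == 0) pts -> forall a, a != 0 -> f a = 0.
Proof.
elim: d f pts => [|d IH] f [|x0 pts] //= H [sz] /andP[x00 ptsn0] /andP[hx hp]
  /andP[/eqP fx fpts] a a0.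
  by case: H => c Hc; rewrite Hc // -(Hc x0).
case: pts sz ptsn0 hx hp fpts => [|x1 pts] // sz ptsn0 hx hp fpts.
have x10 : x1 != 0 by case/andP: ptsn0.
have h : bracket x0 x1 != 0 by case/andP: hx.
have [f' hf' E] := form_factor x00 x10 h H fx.
rewrite E // (IH f' (x1 :: pts)) ?mulr0 //.
apply/allP => y yp; have y0 := allP ptsn0 y yp.
have := allP fpts y yp; rewrite E // mulf_eq0 => /orP[|//].
by rewrite bracket_sym // oppr_eq0 (negbTE (allP hx y yp)).
Qed.

End FixedCenter.

Variable q : K.
Hypothesis q0 : q != 0.

(** The theta shifted factorial [(a; q, p)_k] for natural [k]. *)
Definition pf (a : K) (k : nat) : K := \prod_(i < k) th (a * q ^+ i).

Lemma pf0 a : pf a 0 = 1. Proof. exact: big_ord0. Qed.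

Lemma pfD a k m : pf a (k + m) = pf a k * pf (a * q ^+ k) m.
Proof.
rewrite /pf big_split_ord /=; congr (_ * _); apply: eq_bigr => i _.
by rewrite exprD mulrA.
Qed.

Lemma pf1 a : pf a 1 = th a.
Proof. by rewrite /pf big_ord1 expr0 mulr1. Qed.

Lemma pf_cat a b c k m l : (k + m = l)%N -> a = c -> c * q ^+ k = b ->
  pf c l = pf a k * pf b m.
Proof. by move=> <- -> <-; rewrite pfD. Qed.

Lemma pf_eq0 a k i : (i < k)%N -> a * q ^+ i = 1 -> pf a k = 0.
Proof.
move=> ik e; rewrite /pf (bigD1 (Ordinal ik)) //= e th1 mul0r //.
Qed.

Lemma pf_neq0 a k : (forall i, (i < k)%N -> th (a * q ^+ i) != 0) -> pf a k != 0.
Proof. by move=> h; apply/prodf_neq0 => i _; exact: h. Qed.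

Lemma pf_neq0P a k : pf a k != 0 -> forall i, (i < k)%N -> th (a * q ^+ i) != 0.
Proof.
by move=> /prodf_neq0 h i ik; exact: (h (Ordinal ik)).
Qed.

(** Reversing the factors, which become inverses of those of [pf u L]. *)
Lemma pf_rev u L : u != 0 ->
  pf ((u * q ^+ L)^-1 * q) L = \prod_(t < L) (- (u * q ^+ t)^-1) * pf u L.
Proof.
move=> u0; rewrite /pf (reindex_inj rev_ord_inj) -big_split /=.
apply: eq_bigr => i _.
have -> : (u * q ^+ L)^-1 * q * q ^+ (L - i.+1) = (u * q ^+ i)^-1.
  have {1}-> : (L = i + (1 + (L - i.+1)))%N by have := ltn_ord i; lia.
  by rewrite !exprD expr1; field; rewrite q0 u0 !expf_neq0.
by rewrite thV // mulf_neq0 ?expf_neq0.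
Qed.

(** The [i]-th factors of the two factorials pair up to a bracket with center [g],
    since the product of their arguments is [g] times a square. *)
Lemma form_mul_pf g d f al k : g != 0 -> al != 0 -> form g d f ->
  form g (k + d) (fun a => pf (a * al) k * pf (g * al / a) k * f a).
Proof.
move=> g0 al0 H; elim: k => [|k IH].
  by apply: form_ext H => a _; rewrite !pf0 !mul1r.
have y0 : g * (al * q ^+ k) != 0 by rewrite !mulf_neq0 ?expf_neq0.
have := form_scale (- (g * (al * q ^+ k))) (form_mul_bracket g0 y0 IH).
apply: form_ext => a a0; rewrite -addn1 !pfD !pf1 /bracket.
have -> : a * (g * (al * q ^+ k)) / g = a * al * q ^+ k by field.
have -> : g * al / a * q ^+ k = (a / (g * (al * q ^+ k)))^-1.
  by rewrite invf_div; ring.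
have z0 : a / (g * (al * q ^+ k)) != 0 by rewrite mulf_neq0 // invr_neq0.
rewrite thV //.
by field; rewrite a0 g0 al0 expf_neq0.
Qed.

Lemma form_mul_prod_pf g d f (I : Type) (s : seq I) (al : I -> K) (k : I -> nat) :
  g != 0 -> (forall i, al i != 0) -> form g d f ->
  form g (\sum_(i <- s) k i + d)
    (fun a => (\prod_(i <- s) (pf (a * al i) (k i) * pf (g * al i / a) (k i))) * f a).
Proof.
move=> g0 al0 H; elim: s => [|i s IH].
  by rewrite big_nil; apply: form_ext H => a _; rewrite big_nil mul1r.
rewrite big_cons -addnA.
apply: form_ext (form_mul_pf (k i) g0 (al0 i) IH) => a _.
by rewrite big_cons mulrA.
Qed.

(** * The elliptic Jackson summation for A_n *)

(** The hypothesis [separated] says that the points [q^i x_r] are pairwise distinct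
    for theta; it is what the nonvanishing of the factors [cross] amounts to. *)
Section JacksonSum.
Variables (n : nat) (x : 'I_n -> K).
Hypothesis x0 : forall r, x r != 0.
Implicit Types (j k N : multi n).
Hypothesis separated : forall r s (i j : nat), (r != s) || (i != j) ->
  th ((q ^+ i * x r) / (q ^+ j * x s)) != 0.

Definition node k r : K := q ^+ k r * x r.

Lemma node_neq0 k r : node k r != 0.
Proof. by rewrite mulf_neq0 ?expf_neq0. Qed.

Definition cross N k : K :=
  \prod_(r < n) \prod_(s < n) pf (q * node k r / node k s) (N r - k r).

Lemma cross_neq0 N k : cross N k != 0.
Proof.
apply/prodf_neq0 => r _; apply/prodf_neq0 => s _; apply: pf_neq0 => i _.
have -> : q * node k r / node k s * q ^+ i =
    (q ^+ (k r + i).+1 * x r) / (q ^+ k s * x s).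
  by rewrite /node exprS exprD; field; rewrite x0 expf_neq0.
by apply: separated; case: eqVneq => //= ->; rewrite gtn_eqF // ltnS leq_addr.
Qed.

Lemma crosskk k : cross k k = 1.
Proof. by apply: big1 => r _; apply: big1 => s _; rewrite subnn pf0. Qed.

Lemma cross_cat N k j : lev j k -> lev k N -> cross N j =
  cross k j * \prod_(s < n) \prod_(r < n) pf (q * node k r / node j s) (N r - k r).
Proof.
move=> /levP jk /levP kN; rewrite exchange_big -big_split /=.
apply: eq_bigr => r _; rewrite -big_split /=; apply: eq_bigr => s _.
apply: pf_cat => //; first by have := jk r; have := kN r; lia.
by rewrite /node -{2}(subnKC (jk r)) exprD; field; rewrite x0 expf_neq0.
Qed.

Variables (N : multi n) (b l d : K).
Hypotheses (b0 : b != 0) (l0 : l != 0) (d0 : d != 0).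
Hypothesis pfd : pf (q * l / d) (wt N) != 0.
Hypothesis thl : forall r, th (l * x r) != 0.
Hypothesis pfl : forall r, pf (l * q * x r) (wt N + N r) != 0.

(** The part of the summand that depends neither on [j] nor on [a]. *)
Definition weight k : K :=
  (pf (q * l / d) (wt k))^-1 *
  (\prod_(r < n) (pf (d * x r) (k r) *
     (th (l * x r * q ^+ (k r + wt k)) / th (l * x r)) *
     (pf (b * x r) (k r + wt N) / pf (l * q * x r) (wt k + N r)))) *
  pf (b / l) (wt N - wt k) * (b / l) ^+ wt k / cross N k.

(** The summand and the evaluation are multiplied by the denominators that depend on
    [a], so that both are defined for every nonzero [a]. *)
Definition summand j k a : K :=
  weight k * (\prod_(r < n) pf (l * x r) (j r + wt k)) / cross k j *
  (pf (a * (q * l * q ^+ wt j / (b * d))) (wt k - wt j) *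
   pf (l / a) (wt k - wt j) *
   \prod_(r < n) (pf (a * (q * q ^+ wt j * node k r)) (N r - k r) *
                  pf (b * d * node k r / a) (N r - k r))).

Definition closed_form j a : K :=
  (\prod_(r < n) (pf (d * x r) (j r) * pf (b * d * node j r / l) (N r - j r) *
     pf (b * x r) (j r + wt N))) * (b / l) ^+ wt j / cross N j *
  (pf (a * (q * q ^+ wt j / d)) (wt N - wt j) * pf (b / a) (wt N - wt j)).

(** The common center of all pairs of factors in which [a] occurs. *)
Definition center j : K := b * d / (q * q ^+ wt j).

Lemma center_neq0 j : center j != 0.
Proof. by rewrite !mulf_neq0 ?invr_neq0 ?mulf_neq0 ?expf_neq0. Qed.

Lemma form_summand j k : lev j k -> lev k N ->
  form (center j) (wt N - wt j) (summand j k).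
Proof.
move=> jk kN; pose al1 := q * l * q ^+ wt j / (b * d).
have al10 : al1 != 0 by rewrite !mulf_neq0 ?invr_neq0 ?mulf_neq0 ?expf_neq0.
pose al2 r := q * q ^+ wt j * node k r.
have al20 r : al2 r != 0 by rewrite !mulf_neq0 ?expf_neq0 ?node_neq0.
have F0 : form (center j) 0 (fun=> 1) by exists 1.
have := form_scale (weight k * (\prod_(r < n) pf (l * x r) (j r + wt k)) / cross k j)
  (form_mul_pf (wt k - wt j) (center_neq0 j) al10
    (form_mul_prod_pf (index_enum _) (fun r => N r - k r)%N (center_neq0 j) al20 F0)).
have -> : (wt k - wt j + (\sum_(r < n) (N r - k r) + 0) = wt N - wt j)%N.
  by rewrite addn0 wt_sub // addnC addnBA ?wt_lev // subnK ?wt_lev.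
apply: form_ext => a a0; rewrite /summand mulr1.
congr (_ * (pf _ _ * pf _ _ * _)).
  by rewrite /center /al1; field; rewrite a0 b0 d0 q0 expf_neq0.
apply: eq_bigr => r _; congr (_ * pf _ _).
by rewrite /center /al2; field; rewrite a0 q0 expf_neq0.
Qed.

Lemma form_closed j : lev j N ->
  form (center j) (wt N - wt j) (closed_form j).
Proof.
move=> jN; pose al := q * q ^+ wt j / d.
have al0 : al != 0 by rewrite !mulf_neq0 ?invr_neq0 ?mulf_neq0 ?expf_neq0.
have F0 : form (center j) 0 (fun=> 1) by exists 1.
have := form_scale ((\prod_(r < n) (pf (d * x r) (j r) *
     pf (b * d * node j r / l) (N r - j r) *
     pf (b * x r) (j r + wt N))) * (b / l) ^+ wt j / cross N j)
  (form_mul_pf (wt N - wt j) (center_neq0 j) al0 F0).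
rewrite addn0; apply: form_ext => a a0; rewrite /closed_form mulr1.
congr (_ * (_ * pf _ _)).
by rewrite /center /al; field; rewrite a0 d0 q0 expf_neq0.
Qed.

(** At [a = l] the factorial [pf (l / a)] of length [|k| - |j|] contains the factor
    theta(1). *)
Lemma summand_at_l j k : lev j k -> lev k N -> k != j -> summand j k l = 0.
Proof.
move=> jk kN kj; rewrite /summand (@pf_eq0 (l / l) _ 0) ?mulr0 ?mul0r ?mulr0 //.
  rewrite subn_gt0 ltn_neqAle wt_lev // andbT; apply: contra kj => /eqP e.
  by rewrite (lev_wt_eq jk e).
by rewrite divff // expr0 mulr1.
Qed.

Lemma jackson_at_l j : lev j N ->
  pf (q * l / d) (wt N) * summand j j l = closed_form j l.
Proof.
move=> jN; have wjN := wt_lev jN.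
rewrite /summand crosskk subnn !pf0 !mul1r invr1 mulr1 /weight.
have e1 : pf (q * l / d) (wt N) = pf (q * l / d) (wt j) *
    pf (l * (q * q ^+ wt j / d)) (wt N - wt j).
  by apply: pf_cat => //; [rewrite subnKC|field].
have pfj : pf (q * l / d) (wt j) != 0.
  by move: pfd; rewrite e1 mulf_eq0 negb_or => /andP[].
rewrite /closed_form e1.
have e2 : (\prod_(r < n) (pf (d * x r) (j r) *
     (th (l * x r * q ^+ (j r + wt j)) / th (l * x r)) *
     (pf (b * x r) (j r + wt N) / pf (l * q * x r) (wt j + N r)))) *
   (\prod_(r < n) pf (l * x r) (j r + wt j)) *
   (\prod_(r < n) (pf (l * (q * q ^+ wt j * node j r)) (N r - j r) *
                  pf (b * d * node j r / l) (N r - j r))) =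
   \prod_(r < n) (pf (d * x r) (j r) * pf (b * d * node j r / l) (N r - j r) *
     pf (b * x r) (j r + wt N)).
  rewrite -!big_split /=; apply: eq_bigr => r _.
  have jr := levP _ _ jN r.
  have s1 : pf (l * x r) (j r + wt j) * th (l * x r * q ^+ (j r + wt j)) =
      th (l * x r) * pf (l * q * x r) (j r + wt j).
    rewrite -pf1 -pfD addn1 -[in RHS]pf1; apply: pf_cat (erefl _) _ => //.
    by rewrite expr1; ring.
  have s2 : pf (l * q * x r) (wt j + N r) = pf (l * q * x r) (j r + wt j) *
      pf (l * (q * q ^+ wt j * node j r)) (N r - j r).
    by apply: pf_cat => //; [lia|rewrite /node exprD; ring].
  have p0 : pf (l * q * x r) (wt j + N r) != 0.
    apply: pf_neq0 => i ij; apply: (pf_neq0P (pfl r)); lia.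
  have [p1 p2] : pf (l * q * x r) (j r + wt j) != 0 /\
      pf (l * (q * q ^+ wt j * node j r)) (N r - j r) != 0.
    by move: p0; rewrite s2 mulf_eq0 negb_or => /andP[].
  have tl := thl r; rewrite s2.
  transitivity (pf (d * x r) (j r) * pf (b * d * node j r / l) (N r - j r) *
     pf (b * x r) (j r + wt N) * ((pf (l * x r) (j r + wt j) *
     th (l * x r * q ^+ (j r + wt j))) / (th (l * x r) * pf (l * q * x r) (j r + wt j)))).
    by field; rewrite p1 p2 tl.
  by rewrite s1 divff ?mulr1 // mulf_neq0.
rewrite -e2; field.
by rewrite ?cross_neq0 ?pfj ?l0.
Qed.

(** The interpolation point [a = q^-(1 + |j| + m) / x_i].  The bound [j] and the
    bound [upd j i m] give proportional summands there. *)
Section Reduction.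
Variables (j : multi n) (i : 'I_n) (m : nat).
Hypotheses (jN : lev j N) (jm : (j i <= m)%N) (mN : (m < N i)%N).
Let j' := upd j i m.
Let L := (m.+1 - j i)%N.
Let a := (q ^+ (1 + wt j + m) * x i)^-1.

Let jL : (j i + L = m.+1)%N. Proof. by rewrite subnKC // leqW. Qed.

Let wm : (1 + wt j + m = wt j + (j i + L))%N.
Proof. by rewrite jL add1n addSn addnS. Qed.

Let a0 : a != 0. Proof. by rewrite invr_neq0 // mulf_neq0 ?expf_neq0. Qed.

Let wtj' : wt j' = (wt j + L)%N. Proof. exact: wt_upd. Qed.

Let j'N : lev j' N. Proof. by rewrite lev_upd // jN. Qed.

Let qn (e : nat) : q ^+ e != 0. Proof. exact: expf_neq0. Qed.

Lemma summand_eq0 k : lev j k -> lev k N -> ~~ lev j' k -> summand j k a = 0.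
Proof.
move=> jk kN; rewrite lev_upd // jk /= -leqNgt => km; rewrite /summand.
suff -> : \prod_(r < n) (pf (a * (q * q ^+ wt j * node k r)) (N r - k r) *
                  pf (b * d * node k r / a) (N r - k r)) = 0 by rewrite !mulr0.
rewrite (bigD1 i) //= (@pf_eq0 _ _ (m - k i)) ?mul0r //.
  by rewrite ltn_sub2r // (leq_ltn_trans km mN).
have e : q ^+ m = q ^+ k i * q ^+ (m - k i) by rewrite -exprD subnKC.
by rewrite /a /node !exprD expr1 e; field; rewrite x0 !qn.
Qed.

(** Both factors [cross N _] are split at [k].  The resulting products over [r] of
    the blocks from [k r] to [N r] depend on the lower bound only through its
    [i]-th entry, and at this value of [a] the factorials in [a] are the blocks of
    the opposite bound. *)
Lemma cross_upd k : lev j' k -> lev k N ->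
  (\prod_(r < n) pf (a * (q * q ^+ wt j * node k r)) (N r - k r)) *
    cross k j' * cross N j =
  (\prod_(r < n) pf (a * (q * q ^+ wt j' * node k r)) (N r - k r)) *
    cross k j * cross N j'.
Proof.
move=> j'k kN; have jk : lev j k by move: j'k; rewrite lev_upd // => /andP[].
rewrite (cross_cat jk kN) (cross_cat j'k kN) wtj'.
pose Z (s : 'I_n) (e : nat) :=
  \prod_(r < n) pf (q * node k r / (q ^+ e * x s)) (N r - k r).
have eA : \prod_(r < n) pf (a * (q * q ^+ wt j * node k r)) (N r - k r) = Z i m.+1.
  apply: eq_bigr => r _; congr (pf _ _).
  by rewrite /a /node exprS !exprD expr1; field; rewrite ?x0 ?qn ?q0.
have eA' : \prod_(r < n) pf (a * (q * q ^+ (wt j + L) * node k r)) (N r - k r) =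
    Z i (j i).
  apply: eq_bigr => r _; congr (pf _ _).
  by rewrite /a /node wm !exprD; field; rewrite x0 !qn.
rewrite eA eA'.
have e : (\prod_(s < n) Z s (j' s)) * Z i (j i) = (\prod_(s < n) Z s (j s)) * Z i m.+1.
  by apply: prod_upd; rewrite mulrC.
transitivity (cross k j * cross k j' *
   ((\prod_(s < n) Z s (j s)) * Z i m.+1)); first by rewrite /Z /node; ring.
by rewrite -e /Z /node; ring.
Qed.

(** The factorials in [l / a] and in [l x_i] change by the same factor [P], because
    [l / a] is a power of [q] times [l x_i]. *)
Lemma summand_upd k : lev j' k -> lev k N ->
  summand j k a = pf (a * (q * l * q ^+ wt j / (b * d))) L *
    (cross N j' / cross N j) * summand j' k a.
Proof.
move=> j'k kN; have jk : lev j k by move: j'k; rewrite lev_upd // => /andP[].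
have wj'k := wt_lev j'k; rewrite wtj' in wj'k.
rewrite /summand !big_split /= wtj'.
set A := \prod_(r < n) pf (a * (q * q ^+ wt j * _)) _.
set A' := \prod_(r < n) pf (a * (q * q ^+ (wt j + L) * _)) _.
set B := \prod_(r < n) pf (b * d * _ / a) _.
pose P := pf (l * x i * q ^+ (j i + wt k)) L.
have -> : \prod_(r < n) pf (l * x r) (j' r + wt k) =
    (\prod_(r < n) pf (l * x r) (j r + wt k)) * P.
  rewrite -[LHS]mulr1; apply: (@prod_upd _ _ (fun r e => pf (l * x r) (e + wt k))).
  by rewrite mulr1; apply: pf_cat => //; rewrite -jL addnAC.
have -> : pf (a * (q * l * q ^+ wt j / (b * d))) (wt k - wt j) =
    pf (a * (q * l * q ^+ wt j / (b * d))) L *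
    pf (a * (q * l * q ^+ (wt j + L) / (b * d))) (wt k - (wt j + L)).
  by apply: pf_cat => //; [exact: nat_sub_split|rewrite exprD; ring].
have -> : pf (l / a) (wt k - wt j) = pf (l / a) (wt k - (wt j + L)) * P.
  apply: pf_cat => //; first by rewrite addnC nat_sub_split.
  have e : q ^+ (1 + wt j + m) * q ^+ (wt k - (wt j + L)) = q ^+ (j i + wt k).
    by rewrite -exprD wm nat_sub_shift.
  by rewrite /a invrK -e; ring.
have := cross_upd j'k kN; rewrite wtj' -/A -/A' => E.
have [c1 c2 c3 c4] := And4 (cross_neq0 k j) (cross_neq0 k j')
  (cross_neq0 N j) (cross_neq0 N j').
have {}E : A / cross k j = A' * cross N j' / (cross N j * cross k j').
  apply: (mulIf c1); apply: (mulIf c2); apply: (mulIf c3).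
  transitivity (A * cross k j' * cross N j); first by field.
  by rewrite E; field; rewrite c2.
set W := weight k; set S := \prod_(r < n) pf (l * x r) _.
set p1 := pf _ L; set p2 := pf _ (_ - _); set p3 := pf (l / a) _.
transitivity (W * S * (A / cross k j) * (p1 * p2 * (p3 * P) * B)); first by ring.
by rewrite E; field; rewrite c2 c3.
Qed.

(** The constant is that of [summand_upd]: the blocks in [a] are, after reversal,
    the blocks in [d x_i] and [b d x_i / l], and the monomials produced by the two
    reversals differ by [(b / l)^L]. *)
Lemma closed_form_upd : closed_form j a =
  pf (a * (q * l * q ^+ wt j / (b * d))) L * (cross N j' / cross N j) *
  closed_form j' a.
Proof.
have wj'N := wt_lev j'N; rewrite wtj' in wj'N.
have jiN := levP _ _ jN i.
have [c3 c4] := conj (cross_neq0 N j) (cross_neq0 N j').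
rewrite /closed_form wtj'.
pose D := pf (d * x i * q ^+ j i) L.
pose E := pf (b * d * node j i / l) L.
pose B := pf (b * x i * q ^+ (j i + wt N)) L.
pose F (r : 'I_n) (e : nat) := pf (d * x r) e *
  pf (b * d * (q ^+ e * x r) / l) (N r - e) * pf (b * x r) (e + wt N).
have hF : F i m.+1 * E = F i (j i) * (D * B).
  rewrite /F.
  have -> : pf (d * x i) m.+1 = pf (d * x i) (j i) * D.
    exact: pf_cat jL _ _.
  have -> : pf (b * x i) (m.+1 + wt N) = pf (b * x i) (j i + wt N) * B.
    by apply: pf_cat => //; rewrite -jL addnAC.
  have -> : pf (b * d * (q ^+ j i * x i) / l) (N i - j i) =
      E * pf (b * d * (q ^+ m.+1 * x i) / l) (N i - m.+1).
    rewrite -jL; apply: pf_cat => //; first by rewrite nat_sub_split // jL.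
    by rewrite /node exprD; ring.
  by ring.
have PP : (\prod_(r < n) F r (j' r)) * E = (\prod_(r < n) F r (j r)) * (D * B).
  exact: prod_upd.
have hP k : \prod_(r < n) (pf (d * x r) (k r) * pf (b * d * node k r / l) (N r - k r) *
    pf (b * x r) (k r + wt N)) = \prod_(r < n) F r (k r) by [].
rewrite !hP.
pose w := \prod_(t < L) (- (d * x i * q ^+ j i * q ^+ t)^-1).
have dx0 : d * x i * q ^+ j i != 0 by rewrite !mulf_neq0.
have eT : pf (a * (q * q ^+ wt j / d)) (wt N - wt j) =
    w * D * pf (a * (q * q ^+ (wt j + L) / d)) (wt N - (wt j + L)).
  rewrite /w -pf_rev //; apply: pf_cat; first exact: nat_sub_split.
    by rewrite /a wm !exprD; field; rewrite ?x0 ?qn ?d0.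
  by rewrite !exprD; ring.
have eS : pf (a * (q * l * q ^+ wt j / (b * d))) L * (b / l) ^+ L = w * E.
  have u0 : b * d * node j i / l != 0.
    by rewrite !mulf_neq0 ?invr_neq0 ?node_neq0.
  have -> : a * (q * l * q ^+ wt j / (b * d)) =
      (b * d * node j i / l * q ^+ L)^-1 * q.
    by rewrite /a /node wm !exprD; field; rewrite ?x0 ?qn ?d0 ?l0 ?b0.
  rewrite pf_rev // -/E mulrAC; congr (_ * _).
  have -> : (b / l) ^+ L = \prod_(t < L) (b / l) by rewrite prodr_const card_ord.
  rewrite /w -big_split /=; apply: eq_bigr => t _.
  by rewrite /node; field; rewrite ?x0 ?qn ?d0 ?l0 ?b0.
have eB : pf (b / a) (wt N - wt j) = pf (b / a) (wt N - (wt j + L)) * B.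
  apply: pf_cat => //; first by rewrite addnC nat_sub_split.
  have e : q ^+ (1 + wt j + m) * q ^+ (wt N - (wt j + L)) = q ^+ (j i + wt N).
    by rewrite -exprD wm nat_sub_shift.
  by rewrite /a invrK -e; ring.
rewrite eT eB (exprD (b / l)).
set p1 := pf (a * _) L in eS *; set p2 := pf (a * _) (_ - _); set p3 := pf (b / a) _.
set Pj := \prod_(r < n) F r (j r) in PP *; set Pj' := \prod_(r < n) F r (j' r) in PP *.
transitivity (w * (Pj * (D * B)) * (b / l) ^+ wt j / cross N j * (p2 * p3)).
  by ring.
rewrite -PP; transitivity ((w * E) * Pj' * (b / l) ^+ wt j / cross N j * (p2 * p3)).
  by ring.
by rewrite -eS; field; rewrite ?c3 ?c4 ?l0.
Qed.

End Reduction.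

(* Genericity of [b], which makes the interpolation points distinct: [pfbd]
   separates [l] from the other points, [pfbdd] the other points from each other.
   The bound on [m] in [pfbdd] covers [|j|] plus two entries of [N]. *)
Hypothesis pfbd : forall r m, (m < N r)%N -> th (b * d * x r * q ^+ m / l) != 0.
Hypothesis pfbdd : forall r s m, (m < (wt N + wt N + wt N).+1)%N ->
  th (b * d * x r * x s * q ^+ m.+1) != 0.

Let pt j (im : 'I_n * nat) : K := (q ^+ (1 + wt j + im.2) * x im.1)^-1.

Let pt_neq0 j im : pt j im != 0.
Proof. by rewrite invr_neq0 // mulf_neq0 ?expf_neq0. Qed.

Let thV_neq0 u : u != 0 -> th u != 0 -> th u^-1 != 0.
Proof. by move=> u0 h; rewrite thV // mulf_neq0 // oppr_eq0 invr_neq0. Qed.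

Let bracket_l_pt j i m : lev j N -> (m < N i)%N ->
  bracket (center j) l (pt j (i, m)) != 0.
Proof.
move=> jN mN; rewrite /bracket !mulf_neq0 ?invr_neq0 //.
  have -> : l * pt j (i, m) / center j = (b * d * x i * q ^+ m / l)^-1.
    by rewrite /pt /center !exprD expr1 /=; field; rewrite ?x0 ?b0 ?d0 ?l0 ?q0 ?expf_neq0.
  apply: thV_neq0; last exact: pfbd.
  by rewrite !mulf_neq0 ?invr_neq0 ?expf_neq0.
have -> : l / pt j (i, m) = l * q * x i * q ^+ (wt j + m).
  by rewrite /pt invrK !exprD expr1 /=; ring.
by apply: (pf_neq0P (pfl i)); rewrite -addnS leq_add // wt_lev.
Qed.

Let bracket_pt_pt j i m i' m' : lev j N -> (m < N i)%N -> (m' < N i')%N ->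
  (i != i') || (m != m') ->
  bracket (center j) (pt j (i, m)) (pt j (i', m')) != 0.
Proof.
move=> jN mN mN' ne; rewrite /bracket !mulf_neq0 ?invr_neq0 ?pt_neq0 //.
- have -> : pt j (i, m) * pt j (i', m') / center j =
      (b * d * x i * x i' * q ^+ (wt j + m + m').+1)^-1.
    rewrite /pt /center exprS !exprD expr1 /=; field.
    by rewrite ?x0 ?b0 ?d0 ?l0 ?q0 ?expf_neq0.
  apply: thV_neq0; first by rewrite !mulf_neq0 ?expf_neq0.
  apply: pfbdd; rewrite ltnS !leq_add ?wt_lev //.
    exact: leq_trans (ltnW mN) (leq_wt _ _).
  exact: leq_trans (ltnW mN') (leq_wt _ _).
- have -> : pt j (i, m) / pt j (i', m') =
    (q ^+ (1 + wt j + m') * x i') / (q ^+ (1 + wt j + m) * x i).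
  by rewrite /pt invrK mulrC.
  by apply: separated; rewrite eqn_add2l ![_ == m]eq_sym [_ == i]eq_sym.
- by rewrite mulf_neq0 ?expf_neq0.
Qed.

(** The difference of the two sides is a form of degree [|N| - |j|] in [a] that
    vanishes at [l] and at the [|N| - |j|] points [pt j]. *)
Lemma jackson_sum_generic j a : lev j N -> a != 0 ->
  pf (q * l / d) (wt N) * (\sum_(k <- below N | lev j k) summand j k a) =
  closed_form j a.
Proof.
move: {-1}(wt N - wt j)%N (leqnn (wt N - wt j)) => e.
elim/ltn_ind: e j a => e IH j a wje jN a0.
pose f a := pf (q * l / d) (wt N) * (\sum_(k <- below N | lev j k) summand j k a)
  + (-1) * closed_form j a.
suff : f a = 0.
  by move/eqP; rewrite /f mulN1r subr_eq0 => /eqP.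
pose pairs := [seq (i, m) | i <- enum 'I_n, m <- iota (j i) (N i - j i)].
have in_pairs im : im \in pairs -> (j im.1 <= im.2)%N /\ (im.2 < N im.1)%N.
  move/allpairsPdep => [i [m [_ hm ->]]] /=; move: hm; rewrite mem_iota.
  by rewrite subnKC ?(levP _ _ jN) // => /andP[].
have center0 := center_neq0 j.
apply: (@form_eq0 (center j) center0 (wt N - wt j) f (l :: [seq pt j im | im <- pairs])) => //.
- apply: form_add; apply: form_scale; last exact: form_closed.
  have h k : (k \in below N) && lev j k -> form (center j) (wt N - wt j) (summand j k).
    by move=> /andP[kN jk]; apply: form_summand; rewrite // -mem_below.
  apply: form_ext (form_sum (below N) h) => c c0.
  by rewrite -big_seq_cond.
- rewrite /= size_map size_allpairs_dep; congr _.+1.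
  rewrite -wt_sub // sumnE big_map big_enum /=.
  by apply: eq_bigr => i _; rewrite size_iota.
- by rewrite /= l0; apply/allP => c /mapP[im _ ->].
- rewrite /=; apply/andP; split.
    apply/allP => c /mapP[[i m] /in_pairs[/= _ mN] ->]; exact: bracket_l_pt.
  rewrite pairwise_map.
  have up : uniq pairs.
    apply: allpairs_uniq_dep; first exact: enum_uniq.
      by move=> i _; exact: iota_uniq.
    by move=> [i m] [i' m'] _ _ /= [-> ->].
  move: up; rewrite uniq_pairwise => up.
  apply: (sub_in_pairwise (P := mem pairs) _ _ up); last exact/allP.
  move=> [i m] [i' m'] /in_pairs[/= _ mN] /in_pairs[/= _ mN'] ne.
  by apply: bracket_pt_pt => //; rewrite -negb_and; apply: contra ne => /andP[/eqP-> /eqP->].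
rewrite /=; apply/andP; split.
  rewrite /f big_mkcond (bigD1_seq j) /= ?lev_refl ?mem_below ?below_uniq //.
  rewrite big_seq_cond big1 ?addr0 => [|k /andP[kN kj]]; last first.
    by case: ifP => // jk; apply: summand_at_l; rewrite // -mem_below.
  by rewrite jackson_at_l // mulN1r subrr.
apply/allP => c /mapP[[i m] /in_pairs[/= jm mN] ->].
set a' := pt j (i, m); pose j' := upd j i m.
have j'N : lev j' N by rewrite lev_upd // jN.
have jj' : lev j j'.
  by apply/levP => r; rewrite ffunE; case: eqP => [->|//]; exact: leqW.
rewrite /f (closed_form_upd jN jm mN).
have -> : \sum_(k <- below N | lev j k) summand j k a' =
  pf (a' * (q * l * q ^+ wt j / (b * d))) (m.+1 - j i) *
    (cross N j' / cross N j) * \sum_(k <- below N | lev j' k) summand j' k a'.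
  rewrite mulr_sumr big_mkcond [RHS]big_mkcond /= big_seq [RHS]big_seq.
  apply: eq_bigr => k; rewrite mem_below => kN.
  have [j'k|nj'k] := boolP (lev j' k).
    have jk : lev j k by move: j'k; rewrite lev_upd // => /andP[].
    by rewrite jk; apply: summand_upd.
  case: ifP => // jk; exact: summand_eq0.
rewrite mulrCA (IH (wt N - wt j')%N _ j') ?mulN1r ?subrr //.
  apply: leq_trans wje; have wj' : wt j' = (wt j + (m.+1 - j i))%N := wt_upd jm.
  have wjj' : (wt j < wt j')%N by rewrite wj' -addn1 leq_add2l subn_gt0 ltnS.
  by apply: ltn_sub2l => //; exact: leq_trans wjj' (wt_lev j'N).
exact: pt_neq0.
Qed.

End JacksonSum.
End ThetaForms.

(** * Removing the genericity of [b] *)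

Section JacksonContinuity.
Variables (C : numFieldType) (th : C -> C) (q : C).
Hypothesis thV : forall a, a != 0 -> th a^-1 = - a^-1 * th a.
Hypothesis th_addition : forall x y u w,
  let F s t := th (s * t) * th (s / t) / s in
  x != 0 -> y != 0 -> u != 0 -> w != 0 ->
  F x y * F u w - F x u * F y w + F x w * F y u = 0.
Hypothesis has_sqrt : forall g : C, exists s, s ^+ 2 = g.
Hypothesis th_continuous : forall c, c != 0 ->
  (th t @[t --> c] --> th c)%classic.
Hypothesis th_near_neq0 : forall c, c != 0 ->
  (\forall t \near c^', th t != 0)%classic.
Hypothesis q0 : q != 0.
Local Notation pf := (pf th q).

Lemma th1 : th 1 = 0.
Proof.
have := thV (oner_neq0 C); rewrite invr1 mulN1r => /eqP.
by rewrite -addr_eq0 -mulr2n mulrn_eq0 /= => /eqP.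
Qed.

Definition continuous_at (b : C) (f : C -> C) : Prop :=
  (f t @[t --> b] --> f b)%classic.

Lemma continuous_at_cst b c : continuous_at b (fun=> c).
Proof. exact: (@cvg_cst _ _ _ (nbhs b) (nbhs_filter b)). Qed.

Lemma continuous_at_id b : continuous_at b (fun t => t).
Proof. by move=> A. Qed.

Lemma continuous_atD b f g : continuous_at b f -> continuous_at b g ->
  continuous_at b (fun t => f t + g t).
Proof. exact: (@cvgD _ _ _ _ (nbhs_filter b)). Qed.

Lemma continuous_atM b f g : continuous_at b f -> continuous_at b g ->
  continuous_at b (fun t => f t * g t).
Proof. exact: (@cvgM _ _ _ (nbhs_filter b)). Qed.

Lemma continuous_atV b f : f b != 0 -> continuous_at b f ->
  continuous_at b (fun t => (f t)^-1).
Proof. move=> h hf; exact: (@cvgV _ _ _ (nbhs_filter b) _ _ h hf). Qed.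

Lemma continuous_at_sum b (I : Type) (s : seq I) (P : pred I) (f : I -> C -> C) :
  (forall i, continuous_at b (f i)) ->
  continuous_at b (fun t => \sum_(i <- s | P i) f i t).
Proof.
move=> h; elim: s => [|i s IH].
  rewrite (_ : (fun t => _) = (fun=> 0)); first exact: continuous_at_cst.
  by apply/funext => t; rewrite big_nil.
rewrite (_ : (fun t => _) = (fun t => if P i then f i t + \sum_(j <- s | P j) f j t
   else \sum_(j <- s | P j) f j t)); last by apply/funext => t; rewrite big_cons.
by case: (P i) => //; exact: continuous_atD.
Qed.

Lemma continuous_at_prod b (I : Type) (s : seq I) (f : I -> C -> C) :
  (forall i, continuous_at b (f i)) ->
  continuous_at b (fun t => \prod_(i <- s) f i t).
Proof.
move=> h; elim: s => [|i s IH].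
  rewrite (_ : (fun t => _) = (fun=> 1)); first exact: continuous_at_cst.
  by apply/funext => t; rewrite big_nil.
rewrite (_ : (fun t => _) = (fun t => f i t * \prod_(j <- s) f j t)).
  exact: continuous_atM.
by apply/funext => t; rewrite big_cons.
Qed.

Lemma continuous_atX b f k : continuous_at b f ->
  continuous_at b (fun t => f t ^+ k).
Proof.
move=> h; rewrite (_ : (fun t => _) = (fun t => \prod_(i < k) f t)).
  exact: continuous_at_prod.
by apply/funext => t; rewrite prodr_const card_ord.
Qed.

Lemma continuous_at_pf b f k : f b != 0 -> continuous_at b f ->
  continuous_at b (fun t => pf (f t) k).
Proof.
move=> fb h; apply: continuous_at_prod => i.
have hc : continuous_at b (fun t => f t * q ^+ i).
  by apply: continuous_atM => //; exact: continuous_at_cst.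
have c0 : f b * q ^+ i != 0 by rewrite mulf_neq0 ?expf_neq0.
exact: cvg_comp hc (th_continuous c0).
Qed.

Lemma near_theta_mul_neq0 b c : b != 0 -> c != 0 ->
  (\forall t \near b^', th (c * t) != 0)%classic.
Proof.
move=> b0 c0; have cb0 : c * b != 0 by rewrite mulf_neq0.
have hc : continuous_at b (fun t => c * t).
  by apply: continuous_atM; [exact: continuous_at_cst|exact: continuous_at_id].
have := hc _ (th_near_neq0 cb0); rewrite /nbhs /=.
apply: (@filterS _ _ (nbhs_filter b)) => t h tb; apply: h.
by apply: contra tb => /eqP /(mulfI c0) ->.
Qed.

Section PerturbedSum.
Variables (n : nat) (x : 'I_n -> C).
Hypothesis x0 : forall r, x r != 0.
Hypothesis separated : forall (r s : 'I_n) (i j : nat), (r != s) || (i != j) ->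
  th ((q ^+ i * x r) / (q ^+ j * x s)) != 0.
Variables (N : multi n) (b l d : C).
Hypotheses (b0 : b != 0) (l0 : l != 0) (d0 : d != 0).
Hypothesis pfd : pf (q * l / d) (wt N) != 0.
Hypothesis thl : forall r, th (l * x r) != 0.
Hypothesis pfl : forall r, pf (l * q * x r) (wt N + N r) != 0.

Lemma near_b_forall (I : finType) (M : nat) (c : I -> nat -> C) :
  (forall i m, c i m != 0) ->
  (\forall t \near b^', forall i m, (m < M)%N -> th (c i m * t) != 0)%classic.
Proof.
move=> hc; have h (im : I * 'I_M) : (\forall t \near b^', th (c im.1 im.2 * t) != 0)%classic.
  exact: near_theta_mul_neq0.
have := @filter_forall _ _ _ _ (dnbhs_filter b) h.
apply: (@filterS _ _ (dnbhs_filter b)) => t H i m mM.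
exact: (H (i, Ordinal mM)).
Qed.

(** If the two sides differed at [b], they would differ near [b] by continuity; but
    the values near [b], except [b] itself, satisfy the finitely many conditions of
    genericity. *)
Lemma jackson_sum j a : lev j N -> a != 0 ->
  pf (q * l / d) (wt N) *
    (\sum_(k <- below N | lev j k) summand th q x N b l d j k a) =
  closed_form th q x N b l d j a.
Proof.
move=> jN a0.
pose E t := pf (q * l / d) (wt N) *
    (\sum_(k <- below N | lev j k) summand th q x N t l d j k a) +
  (-1) * closed_form th q x N t l d j a.
suff : E b = 0 by move/eqP; rewrite /E mulN1r subr_eq0 => /eqP.
have qn k : q ^+ k != 0 by rewrite expf_neq0.
have nd k r : node q x k r != 0 by rewrite mulf_neq0.
have cE : continuous_at b E.
  have cc := @continuous_at_cst b; have ci := @continuous_at_id b.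
  apply: continuous_atD; apply: continuous_atM => //.
    apply: continuous_at_sum => k.
    do ![apply: continuous_atM => //].
    - apply: continuous_at_prod => r; do ![apply: continuous_atM => //].
      by apply: continuous_at_pf; [rewrite mulf_neq0|exact: continuous_atM].
    - apply: continuous_at_pf; first by rewrite mulf_neq0 ?invr_neq0.
      exact: continuous_atM.
    - by apply: continuous_atX; exact: continuous_atM.
    - apply: continuous_at_pf; first by rewrite !mulf_neq0 ?invr_neq0 ?mulf_neq0.
      do ![apply: continuous_atM => //].
      by apply: continuous_atV; [rewrite mulf_neq0|exact: continuous_atM].
    - apply: continuous_at_prod => r; apply: continuous_atM => //.
      apply: continuous_at_pf; first by rewrite !mulf_neq0 ?invr_neq0.
      do ![apply: continuous_atM => //].
  do ![apply: continuous_atM => //].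
  - apply: continuous_at_prod => r; do ![apply: continuous_atM => //].
      apply: continuous_at_pf; first by rewrite !mulf_neq0 ?invr_neq0.
      do ![apply: continuous_atM => //].
    by apply: continuous_at_pf; [rewrite mulf_neq0|exact: continuous_atM].
  - by apply: continuous_atX; exact: continuous_atM.
  - apply: continuous_at_pf; first by rewrite mulf_neq0 ?invr_neq0.
    exact: continuous_atM.
apply/eqP; apply/negP => /negP Eb.
have H1 : (\forall t \near b^', E t != 0)%classic.
  apply: nbhs_dnbhs; exact: (@cvgr_neq0 _ _ _ _ (nbhs_filter b) _ _ cE Eb).
have c2 (r : 'I_n) m : d * x r * q ^+ m / l != 0.
  by rewrite !mulf_neq0 ?invr_neq0.
have H2 := near_b_forall (wt N) c2.
have c3 (rs : 'I_n * 'I_n) m : d * x rs.1 * x rs.2 * q ^+ m.+1 != 0.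
  by rewrite !mulf_neq0.
have H3 := near_b_forall (wt N + wt N + wt N).+1 c3.
have H4 : (\forall t \near b^', t != 0)%classic.
  apply: nbhs_dnbhs.
  exact: (@cvgr_neq0 _ _ _ _ (nbhs_filter b) _ _ (@continuous_at_id b) b0).
have [t [[h1 h2] [h3 h4]]] := filter_ex (filterI (filterI H1 H2) (filterI H3 H4)).
case/negP: h1; rewrite /E mulN1r subr_eq0; apply/eqP.
apply: jackson_sum_generic => //; first exact: th1.
- move=> r m mN; have -> : t * d * x r * q ^+ m / l = d * x r * q ^+ m / l * t by ring.
  by apply: h2; exact: leq_trans mN (leq_wt _ _).
- move=> r s m mS; have -> : t * d * x r * x s * q ^+ m.+1 =
    d * x r * x s * q ^+ m.+1 * t by ring.
  exact: (h3 (r, s)).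
Qed.

End PerturbedSum.
End JacksonContinuity.

(** * The Bailey lemma *)

Section BaileyLemma.
Variables (C : numFieldType) (p q : C).
Local Notation th := (theta p).
Hypothesis thV : forall a, a != 0 -> th a^-1 = - a^-1 * th a.
Hypothesis th_addition : forall x y u w,
  let F s t := th (s * t) * th (s / t) / s in
  x != 0 -> y != 0 -> u != 0 -> w != 0 ->
  F x y * F u w - F x u * F y w + F x w * F y u = 0.
Hypothesis has_sqrt : forall g : C, exists s, s ^+ 2 = g.
Hypothesis th_continuous : forall c, c != 0 ->
  (th t @[t --> c] --> th c)%classic.
Hypothesis th_near_neq0 : forall c, c != 0 ->
  (\forall t \near c^', th t != 0)%classic.
Hypothesis q0 : q != 0.
Local Notation pf := (pf th q).
Variables (n : nat) (x : 'I_n -> C).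
Hypothesis x0 : forall r, x r != 0.
Local Notation cross := (cross th q x).
Implicit Types (j k N : multi n).

Lemma qpfactE a (k : nat) : qpfact q p a k = pf a k. Proof. by []. Qed.

Lemma qpfact_sub a (m k : nat) : (k <= m)%N ->
  qpfact q p a (m%:Z - k%:Z) = pf a (m - k).
Proof. by move=> h; rewrite subzn. Qed.

Lemma mleP j k : reflect (mle j k) (lev j k).
Proof. exact: levP. Qed.

Lemma crossfactE k j : lev j k -> crossfact q p x k j = cross k j.
Proof.
move=> /levP jk; apply: eq_bigr => r _; apply: eq_bigr => s _.
rewrite qpfact_sub //; congr (pf _ _).
rewrite !expfzDr // expr1z -exprnN -exprnP /node; field.
by rewrite x0 expf_neq0.
Qed.

(** Each value needed is the first factor of some entry of [cross], for suitable
    multi-indices; for equal nodes and a negative power of [q] it is the inverse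
    of such a value. *)
Lemma separated_of_cross :
  (forall N j, lev j N -> cross N j != 0) ->
  forall (r s : 'I_n) (i m : nat), (r != s) || (i != m) ->
  th ((q ^+ i * x r) / (q ^+ m * x s)) != 0.
Proof.
move=> H.
have fac N j r s t : lev j N -> (t < N r - j r)%N ->
    th (q * node q x j r / node q x j s * q ^+ t) != 0.
  move=> jN tN; have /prodf_neq0 /(_ r isT) /prodf_neq0 /(_ s isT) := H N j jN.
  by move/pf_neq0P; apply.
move=> r s i m; have [<-|rs] := eqVneq r s => /= h.
  have pos (u v : nat) : (u < v)%N -> th ((q ^+ v * x r) / (q ^+ u * x r)) != 0.
    move=> uv; pose J : multi n := [ffun=> 0%N]; pose N : multi n := [ffun=> v].
    have JN : lev J N by apply/levP => t; rewrite !ffunE.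
    have := fac N J r r (v - u.+1)%N JN; rewrite !ffunE subn0 => /(_ _).
    have -> : (q ^+ v * x r) / (q ^+ u * x r) =
        q * node q x J r / node q x J r * q ^+ (v - u.+1).
      rewrite -{1}(subnKC uv) exprD exprS; field.
      by rewrite node_neq0 // x0 expf_neq0.
    by apply; lia.
  have [im|mi|e] := ltngtP i m; last by rewrite e eqxx in h.
    have -> : q ^+ i * x r / (q ^+ m * x r) = (q ^+ m * x r / (q ^+ i * x r))^-1.
      by rewrite invf_div.
    rewrite thV ?mulf_neq0 ?oppr_eq0 ?invr_neq0 ?pos //;
    by rewrite ?mulf_neq0 ?invr_neq0 ?mulf_neq0 ?expf_neq0.
  exact: pos.
pose J : multi n := [ffun t => if t == r then i else m.+1].
pose N : multi n := [ffun t => (J t).+1].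
have JN : lev J N by apply/levP => t; rewrite !ffunE.
have := fac N J r s 0%N JN; rewrite [N r]ffunE subSnn expr0 mulr1 => /(_ isT).
suff -> : q * node q x J r / node q x J s = q ^+ i * x r / (q ^+ m * x s) by [].
rewrite /node !ffunE eqxx [s == r]eq_sym (negbTE rs) exprS; field.
by rewrite q0 x0 expf_neq0.
Qed.

Variables (rho1 rho2 : C).
Hypotheses (hrho1 : rho1 != 0) (hrho2 : rho2 != 0).

Section Coefficients.
Variables (a b : C) (N : multi n).
Hypothesis gen : B1_generic q p x a b.
Hypothesis gen' : prime_generic q p x rho1 rho2 a b.
Let l := b * rho1 * rho2 / (a * q).

Definition beta_coef (k : multi n) : C :=
  pf rho1 (wt k) / pf (b * rho1 / a) (wt k)
      * (\prod_(r < n) (pf (rho2 * x r) (k r) / pf (b * rho2 * x r / a) (k r)))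
      * (\prod_(r < n)
           (th (b * rho1 * rho2 * x r * q ^+ (k r + wt k) / (a * q))
            / th (b * rho1 * rho2 * x r / (a * q))
            * (pf (b * x r) (k r + wt N)
               / pf (b * rho1 * rho2 * x r / a) (wt k + N r))))
      * (pf (a * q / (rho1 * rho2)) (wt N - wt k) / cross N k)
      * (a * q / (rho1 * rho2)) ^+ wt k.

Definition beta_prefactor : C :=
  pf (b * rho1 / a) (wt N) / pf (a * q / rho2) (wt N)
  * (\prod_(r < n) (pf (b * rho2 * x r / a) (N r) / pf (a * x r * q / rho1) (N r))).

Definition alpha_coef (j : multi n) : C :=
  pf rho1 (wt j) / pf (a * q / rho2) (wt j)
  * (\prod_(r < n) (pf (rho2 * x r) (j r) / pf (a * x r * q / rho1) (j r)))
  * (a * q / (rho1 * rho2)) ^+ wt j.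

Definition B1coef (k j : multi n) (b' : C) : C :=
  pf (b' / a) (wt k - wt j) / cross k j
  * \prod_(r < n) (pf (b' * x r) (j r + wt k) / pf (a * x r * q) (k r + wt j)).

Lemma B1E k j b' : lev j k -> B1 q p x k j a b' = B1coef k j b'.
Proof. by move=> jk; rewrite /B1 crossfactE // qpfact_sub ?wt_lev. Qed.

Let a0 : a != 0. Proof. by case: gen. Qed.
Let b0 : b != 0. Proof. by case: gen. Qed.
Let l0 : l != 0.
Proof. by rewrite /l !mulf_neq0 ?invr_neq0 ?mulf_neq0. Qed.

Let cross0 k j : lev j k -> cross k j != 0.
Proof.
by move=> jk; case: gen => _ _ /(_ k j (mleP _ _ jk)) [+ _]; rewrite crossfactE.
Qed.

Let pfaxq r (k : nat) j : (k <= N r)%N -> lev j N ->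
  pf (a * x r * q) (k + wt j) != 0.
Proof.
move=> kN jN; case: gen => _ _ /(_ N j (mleP _ _ jN)) [_ /(_ r)].
rewrite qpfactE => h; apply: pf_neq0 => i ik; apply: (pf_neq0P h).
by apply: leq_trans ik _; rewrite leq_add2r.
Qed.

Let pfb_r r (k : nat) : (k <= N r)%N -> pf (b * rho2 * x r / a) k != 0.
Proof.
move=> kN; case: gen' => _ /(_ N N (mleP _ _ (lev_refl N))) [_ /(_ r) [h _ _]].
by apply: pf_neq0 => i ik; apply: (pf_neq0P h); exact: leq_trans ik kN.
Qed.

(** In the substitution below, the weights of the transformed sequence and of the
    matrix combine into a summand of the Jackson sum with [l = b rho1 rho2/(a q)]
    and [d = rho2]. *)
Lemma beta_coef_summand k j : lev j k -> lev k N ->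
  beta_coef k * B1coef k j l =
  pf rho1 (wt j) /
    (\prod_(r < n) (pf (a * x r * q) (N r + wt j) * pf (b * rho2 * x r / a) (N r))) *
  summand th q x N b l rho2 j k a.
Proof.
move=> jk kN; have jN := lev_trans jk kN.
rewrite /beta_coef /B1coef /summand /weight.
have e1 : a * q / (rho1 * rho2) = b / l.
  by rewrite /l; field; rewrite a0 b0 q0 hrho1 hrho2.
have e2 : q * l / rho2 = b * rho1 / a.
  by rewrite /l; field; rewrite a0 q0 hrho2.
have e3 : a * (q * l * q ^+ wt j / (b * rho2)) = rho1 * q ^+ wt j.
  by rewrite /l; field; rewrite a0 b0 q0 hrho2.
have e4 : pf rho1 (wt k) = pf rho1 (wt j) * pf (rho1 * q ^+ wt j) (wt k - wt j).
  by apply: pf_cat => //; rewrite subnKC // wt_lev.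
rewrite e1 e2 e3 e4.
set U := pf (rho1 * _) _; set V := pf (l / a) _; set W := pf (b / l) _.
have prods : (\prod_(r < n) (pf (rho2 * x r) (k r) / pf (b * rho2 * x r / a) (k r)))
  * (\prod_(r < n)
           (th (b * rho1 * rho2 * x r * q ^+ (k r + wt k) / (a * q))
            / th (b * rho1 * rho2 * x r / (a * q))
            * (pf (b * x r) (k r + wt N)
               / pf (b * rho1 * rho2 * x r / a) (wt k + N r))))
  * \prod_(r < n) (pf (l * x r) (j r + wt k) / pf (a * x r * q) (k r + wt j)) =
  (\prod_(r < n) (pf (a * x r * q) (N r + wt j) * pf (b * rho2 * x r / a) (N r)))^-1
  * (\prod_(r < n) (pf (rho2 * x r) (k r) *
     (th (l * x r * q ^+ (k r + wt k)) / th (l * x r)) *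
     (pf (b * x r) (k r + wt N) / pf (l * q * x r) (wt k + N r))))
  * (\prod_(r < n) pf (l * x r) (j r + wt k))
  * \prod_(r < n) (pf (a * (q * q ^+ wt j * node q x k r)) (N r - k r) *
                  pf (b * rho2 * node q x k r / a) (N r - k r)).
  rewrite -prodfV -!big_split /=; apply: eq_bigr => r _.
  have kNr := levP _ _ kN r.
  have -> : b * rho1 * rho2 * x r * q ^+ (k r + wt k) / (a * q) =
      l * x r * q ^+ (k r + wt k) by rewrite /l; ring.
  have -> : b * rho1 * rho2 * x r / (a * q) = l * x r by rewrite /l; ring.
  have -> : b * rho1 * rho2 * x r / a = l * q * x r.
    by rewrite /l; field; rewrite a0 q0.
  have s1 : pf (a * x r * q) (N r + wt j) = pf (a * x r * q) (k r + wt j) *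
      pf (a * (q * q ^+ wt j * node q x k r)) (N r - k r).
    apply: pf_cat => //; first by rewrite addnAC subnKC.
    by rewrite /node exprD; ring.
  have s2 : pf (b * rho2 * x r / a) (N r) = pf (b * rho2 * x r / a) (k r) *
      pf (b * rho2 * node q x k r / a) (N r - k r).
    by apply: pf_cat => //; [rewrite subnKC|rewrite /node; ring].
  have := pfaxq (leqnn (N r)) jN; have := pfb_r (leqnn (N r)).
  rewrite s1 s2 !mulf_eq0 !negb_or => /andP[n1 n2] /andP[n3 n4].
  set T1 := th _ / th _; set T2 := pf (b * x r) _ / _.
  by field; rewrite n1 n2 n3 n4.
transitivity (pf rho1 (wt j) * U * V * W * (b / l) ^+ wt k /
   (pf (b * rho1 / a) (wt k) * cross N k * cross k j) *
  ((\prod_(r < n) (pf (rho2 * x r) (k r) / pf (b * rho2 * x r / a) (k r)))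
  * (\prod_(r < n)
           (th (b * rho1 * rho2 * x r * q ^+ (k r + wt k) / (a * q))
            / th (b * rho1 * rho2 * x r / (a * q))
            * (pf (b * x r) (k r + wt N)
               / pf (b * rho1 * rho2 * x r / a) (wt k + N r))))
  * \prod_(r < n) (pf (l * x r) (j r + wt k) / pf (a * x r * q) (k r + wt j)))).
  by rewrite !invfM; ring.
by rewrite prods !invfM; ring.
Qed.

(** Clearing denominators turns [jackson_sum] into the identity between the
    coefficients of [alpha j a l] on the two sides. *)
Lemma coefficient_identity j : lev j N ->
  beta_prefactor * (\sum_(k <- below N | lev j k) beta_coef k * B1coef k j l) =
  B1coef N j b * alpha_coef j.
Proof.
move=> jN.
have -> : \sum_(k <- below N | lev j k) beta_coef k * B1coef k j l =
  pf rho1 (wt j) /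
    (\prod_(r < n) (pf (a * x r * q) (N r + wt j) * pf (b * rho2 * x r / a) (N r))) *
  \sum_(k <- below N | lev j k) summand th q x N b l rho2 j k a.
  rewrite mulr_sumr big_seq_cond [RHS]big_seq_cond; apply: eq_bigr => k.
  by rewrite mem_below => /andP[kN jk]; exact: beta_coef_summand.
have e2 : q * l / rho2 = b * rho1 / a.
  by rewrite /l; field; rewrite a0 q0 hrho2.
have [g1 g2] := gen'.
have [h1 h2] := g2 N N (mleP _ _ (lev_refl N)).
have pfd : pf (q * l / rho2) (wt N) != 0 by rewrite e2.
have thl r : th (l * x r) != 0.
  by have [_ + _] := h2 r; rewrite /l mulrAC.
have pfl r : pf (l * q * x r) (wt N + N r) != 0.
  have [_ _ +] := h2 r.
  have -> : b * rho1 * rho2 * x r / a = l * q * x r.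
    by rewrite /l; field; rewrite a0 q0.
  by [].
have sep := separated_of_cross cross0.
have J := jackson_sum thV th_addition has_sqrt th_continuous th_near_neq0 q0 x0
  sep b0 l0 hrho2 pfd thl pfl jN a0.
rewrite e2 in J; rewrite /beta_prefactor.
set S := \sum_(_ <- _ | _) _ in J *.
transitivity (pf rho1 (wt j) / pf (a * q / rho2) (wt N) *
  ((\prod_(r < n) (pf (b * rho2 * x r / a) (N r) / pf (a * x r * q / rho1) (N r))) /
   (\prod_(r < n) (pf (a * x r * q) (N r + wt j) * pf (b * rho2 * x r / a) (N r)))) *
  (pf (b * rho1 / a) (wt N) * S)); first by ring.
rewrite J /closed_form /B1coef /alpha_coef.
have e1 : a * q / (rho1 * rho2) = b / l.
  by rewrite /l; field; rewrite a0 b0 q0 hrho1 hrho2.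
have e5 : pf (a * q / rho2) (wt N) = pf (a * q / rho2) (wt j) *
    pf (a * (q * q ^+ wt j / rho2)) (wt N - wt j).
  by apply: pf_cat => //; [rewrite subnKC // wt_lev|ring].
have [+ _] := g1 N; rewrite qpfactE e5 mulf_eq0 negb_or => /andP[n1 n2].
rewrite e1.
have prods : (\prod_(r < n) (pf (b * rho2 * x r / a) (N r) / pf (a * x r * q / rho1) (N r))) /
   (\prod_(r < n) (pf (a * x r * q) (N r + wt j) * pf (b * rho2 * x r / a) (N r))) *
   (\prod_(r < n) (pf (rho2 * x r) (j r) * pf (b * rho2 * node q x j r / l) (N r - j r) *
     pf (b * x r) (j r + wt N))) =
   (\prod_(r < n) (pf (b * x r) (j r + wt N) / pf (a * x r * q) (N r + wt j))) *
   (\prod_(r < n) (pf (rho2 * x r) (j r) / pf (a * x r * q / rho1) (j r))).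
  rewrite -prodfV -!big_split /=; apply: eq_bigr => r _.
  have jNr := levP _ _ jN r.
  have s1 : pf (a * x r * q / rho1) (N r) = pf (a * x r * q / rho1) (j r) *
      pf (b * rho2 * node q x j r / l) (N r - j r).
    apply: pf_cat => //; first by rewrite subnKC.
    by rewrite /l /node; field; rewrite a0 b0 q0 hrho1 hrho2.
  have := pfaxq (leqnn (N r)) jN; have := pfb_r (leqnn (N r)).
  have [_ /(_ r)] := g1 N; rewrite qpfactE s1 mulf_eq0 negb_or => /andP[n3 n4] n5 n6.
  by field; rewrite n3 n4 n5 n6.
have c0 := cross0 jN.
transitivity (pf rho1 (wt j) / (pf (a * q / rho2) (wt j) *
    pf (a * (q * q ^+ wt j / rho2)) (wt N - wt j)) *
  pf (a * (q * q ^+ wt j / rho2)) (wt N - wt j) * pf (b / a) (wt N - wt j) *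
  (b / l) ^+ wt j / cross N j *
  ((\prod_(r < n) (pf (b * x r) (j r + wt N) / pf (a * x r * q) (N r + wt j))) *
   (\prod_(r < n) (pf (rho2 * x r) (j r) / pf (a * x r * q / rho1) (j r))))).
  by rewrite -prods; ring.
set P1 := \prod_(r < n) _; set P2 := \prod_(r < n) _.
by field; rewrite ?l0 ?n1 ?n2 ?c0.
Qed.

End Coefficients.

Lemma bailey_lemma (D : C -> C -> Prop) (alpha beta : multi n -> C -> C -> C) :
  WP_Bailey_pair (fun a b => D a b /\ B1_generic q p x a b)
    (B1 q p x) alpha beta ->
  WP_Bailey_pair
    (fun a b => [/\ D a (b * rho1 * rho2 / (a * q)),
                    B1_generic q p x a b &
                    prime_generic q p x rho1 rho2 a b])
    (B1 q p x) (alpha' q p x rho1 rho2 alpha) (beta' q p x rho1 rho2 beta).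
Proof.
move=> H N a b [hD gen gen']; have [a0 b0 gen0] := gen.
set l := b * rho1 * rho2 / (a * q) in hD *.
have l0 : l != 0 by rewrite /l !mulf_neq0 ?invr_neq0 ?mulf_neq0.
have genl : D a l /\ B1_generic q p x a l by [].
rewrite sum_belowE /beta' sum_belowE.
transitivity (beta_prefactor a b N * (\sum_(k <- below N)
   \sum_(j <- below k) beta_coef a b N k * B1coef a k j l * alpha j a l)).
  congr (_ * _); rewrite big_seq [RHS]big_seq; apply: eq_bigr => k.
  rewrite mem_below => kN.
  rewrite (H k a l genl) sum_belowE crossfactE // qpfact_sub ?wt_lev //.
  rewrite mulr_sumr big_seq [RHS]big_seq; apply: eq_bigr => j.
  rewrite mem_below => jk; rewrite B1E // mulrA; congr (_ * _ * _).
rewrite exchange_below mulr_sumr big_seq [RHS]big_seq; apply: eq_bigr => j.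
rewrite mem_below => jN; rewrite B1E // /alpha' -/l.
rewrite -mulr_suml mulrA coefficient_identity //.
by rewrite -!mulrA.
Qed.

End BaileyLemma.

Theorem theorem4p6 (R : realType) (n : nat) (hn : (1 <= n)%N)
    (q p : R[i]) (hq : q != 0) (hp : `|p| < 1)
    (x : 'I_n -> R[i]) (hx : forall r, x r != 0)
    (rho1 rho2 : R[i]) (hrho1 : rho1 != 0) (hrho2 : rho2 != 0)
    (D : R[i] -> R[i] -> Prop)
    (alpha beta : multi n -> R[i] -> R[i] -> R[i]) :
  WP_Bailey_pair (fun a b => D a b /\ B1_generic q p x a b)
    (B1 q p x) alpha beta ->
  WP_Bailey_pair
    (fun a b => [/\ D a (b * rho1 * rho2 / (a * q)),
                    B1_generic q p x a b &
                    prime_generic q p x rho1 rho2 a b])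
    (B1 q p x) (alpha' q p x rho1 rho2 alpha) (beta' q p x rho1 rho2 beta).
Proof.
apply: (@bailey_lemma (R[i] : numFieldType) p q) => //.
- exact: complex_thetaV hp.
- exact: complex_theta_addition hp.
- by move=> g; exists (sqrtc g); exact: sqr_sqrtc.
- exact: complex_theta_continuous hp.
- exact: complex_theta_near_neq0 hp.
Qed.
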